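(* Run the algorithm MDPP-K (described in the context) for $T$ episodes in a Markov decision process with unknown transition kernel $p$ and initial state-action distribution $\rho$, against an arbitrary sequence of objectives $F_t(\mu)=\sum_{n=1}^N f_{t,n}(\mu_n)$, where each $f_{t,n}:\mathbb{R}^{\mathcal X\times\mathcal A}\to\mathbb{R}$ is convex and $\ell$-Lipschitz with respect to $\|\cdot\|_1$. Assume the set of periodic policies is non-empty and that there is $0\le\alpha<1$ with $\|\nu P_\pi-\nu'P_\pi\|_1\le\alpha\|\nu-\nu'\|_1$ for all periodic policies $\pi$ and all $\nu,\nu'\in\Delta_{\mathcal X\times\mathcal A}$. Run the algorithm with $\bar\alpha=\alpha$ and the optimal choice of $\eta>0$, and suppose $\|\nabla\psi(\mu_t)\|_{1,\infty}\le\Psi$ for all $t$. Then, for any periodic policy $\pi$, with high probability, $$R_T(\pi)\le\tilde O\Big(\ell N^3|\mathcal X|^{5/4}|\mathcal A|^{1/4}\sqrt{\Psi(1-\alpha)^{-1}}\,T^{3/4}+(1-\alpha)^{-1}\ell N^4|\mathcal X|^2\sqrt{|\mathcal A|T}\Big),$$ where $R_T(\pi)=\sum_{t=1}^T[F_t(\mu^{\pi_t,\rho_t})-F_t(\mu^{\pi,\rho})]+\gamma\sum_{t=1}^T\|\rho_t-\rho\|_1$ is the periodic regret, $\gamma>0$ being fixed.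
   Context: MDP. $\mathcal X,\mathcal A$ are finite; $\Delta_S$ is the probability simplex over a finite set $S$; $[N]=\{1,\dots,N\}$. The horizon is $N$, the kernel is $p=(p_n)_{n\in[N]}$ with $p_n(\cdot|x,a)\in\Delta_{\mathcal X}$, and $\rho\in\Delta_{\mathcal X\times\mathcal A}$. A policy is $\pi=(\pi_n)_{n\in[N]}$ with $\pi_n(\cdot|x)\in\Delta_{\mathcal A}$. For $\nu\in\Delta_{\mathcal X\times\mathcal A}$, $\mu^{\pi,\nu}=(\mu_n^{\pi,\nu})_{0\le n\le N}$ is given by $\mu_0^{\pi,\nu}=\nu$ and $\mu_{n+1}^{\pi,\nu}(x,a)=\sum_{x',a'}\mu_n^{\pi,\nu}(x',a')p_{n+1}(x|x',a')\pi_{n+1}(a|x)$. $P_\pi$ is the stochastic matrix on $\mathcal X\times\mathcal A$ with $\nu P_\pi=\mu_N^{\pi,\nu}$ for all $\nu$. A policy $\pi$ is periodic if $\rho P_\pi=\rho$. Given another kernel $q$, $\mathcal M_\nu^q$ is the set of sequences $\mu=(\mu_n)_{0\le n\le N}$ of distributions on $\mathcal X\times\mathcal A$ with $\mu_0=\nu$ and $\sum_a\mu_{n+1}(x,a)=\sum_{x',a'}\mu_n(x',a')q_{n+1}(x|x',a')$. Each such $\mu$ is induced by the policy $\pi_n(a|x)=\mu_n(x,a)/\sum_{a'}\mu_n(x,a')$ (arbitrary where the denominator is zero). Interaction (no resets, $M>1$ homogeneous agents). Episode $1$ starts from $\rho_1=\rho$; if $\pi_t$ is played in episode $t$ then $\rho_{t+1}=\rho_tP_{\pi_t}$,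 and the learner observes $\rho_{t+1}$. In each episode one trajectory $(x_{t,n},a_{t,n})_{0\le n\le N}$ of a sampled agent is observed, independently of earlier observations: conditionally on the past observed trajectories $\mathcal F_t$, it starts from $\rho_t$ and follows $\pi_t$ and $p$. $F_t$ is revealed at the end of episode $t$. Estimates. $N_{t,n}(x,a)$ is the number of $s<t$ with $(x_{s,n},a_{s,n})=(x,a)$, $M_{t,n}(x'|x,a)$ the number of $s<t$ with also $x_{s,n+1}=x'$; $\hat p_{t,n+1}(x'|x,a)=M_{t,n}(x'|x,a)/\max\{1,N_{t,n}(x,a)\}$ (uniform if $(x,a)$ is unvisited). $\hat\mu_t^{\pi,\nu}$ is defined as $\mu^{\pi,\nu}$ with $\hat p_t$ instead of $p$; $\mathcal M_t=\mathcal M_{\rho_t}^{\hat p_t}$. For $\delta\in(0,1)$ let $C_\delta=\sqrt{2|\mathcal X|\log(|\mathcal X||\mathcal A|NT/\delta)}$ and, for $0\le n\le N-1$, $b_{t,n}(x,a)=C_\delta/\sqrt{\max\{1,N_{t,n}(x,a)\}}$, $\bar b_{t,n}(x,a)=\ell(N-n)C_\delta/\sqrt{\max\{1,N_{t,n}(x,a)\}}$. $\langle u,v\rangle=\sum_n\sum_{x,a}u_n(x,a)v_n(x,a)$, undefined components being zero. MDPP-K. Start with a policy $\pi_1$, $\mu_1=\hat\mu_1^{\pi_1,\rho_1}$. With $\ell_t=\nabla F_t(\mu_t)$, compute $\mu_{t+1}\in\arg\min\{\eta\langle\ell_t-\bar b_t,\mu\rangle+D_\psi(\mu,\mu_t)\}$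 over $\mu\in\mathcal M_{t+1}$ with $\|\mu_N-\rho\|_1\le\langle\mu,b_{t+1}\rangle+\bar\alpha\|\rho_{t+1}-\rho\|_1$, and let $\pi_{t+1}$ be the policy inducing $\mu_{t+1}$, so that $\mu_t=\hat\mu_t^{\pi_t,\rho_t}$. Divergence. $D_\psi(\mu,\mu')=\psi(\mu)-\psi(\mu')-\langle\nabla\psi(\mu'),\mu-\mu'\rangle$ is one of: (KL) $\sum_{n=0}^N\sum_{x,a}\mu_n\log(\mu_n/\mu_n')$; or ($\Gamma$) $\sum_{n=1}^N\sum_{x,a}\mu_n(x,a)\log(\pi_n(a|x)/\pi_n'(a|x))+\sum_{x,a}\mu_0\log(\mu_0/\mu_0')$, with $\pi,\pi'$ the policies inducing $\mu,\mu'$. $\|v\|_{1,\infty}=\sum_n\|v_n\|_\infty$. Conventions. ''With high probability'': for every $\delta\in(0,1)$ (the parameter in $C_\delta$), with probability at least $1-c\delta$, $c$ universal. $\tilde O(g)$: at most $C\,g\,\log^k(|\mathcal X||\mathcal A|NT/\delta)$ with universal $C,k$, for all $T$ larger than a threshold depending on the other parameters. ''Optimal choice of $\eta$'': the choice, depending only on $T,N,|\mathcal X|,|\mathcal A|,\alpha,\ell,\Psi,\delta$ and $\psi(\mu_1)$, that optimises the regret bound. *)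

(* Defs.v *)
From HB Require Import structures.
From mathcomp Require Import all_boot all_order all_algebra.
From mathcomp Require Import all_classical all_reals all_analysis.

Set Implicit Arguments.
Unset Strict Implicit.
Unset Printing Implicit Defensive.

Import Order.TTheory GRing.Theory Num.Theory.

Local Open Scope classical_set_scope.
Local Open Scope ring_scope.

(* Encoding: time-indexed objects are functions on [nat] of which only a finite
   range is meaningful.  A sequence of state-action functions (u_n)_(0<=n<=N) is
   [u : nat -> X * A -> R]; a kernel is [p n (x, a) x'] = p_n(x'|x,a) and a policy
   [pi n x a] = pi_n(a|x), both for 1 <= n <= N.  Episodes are numbered from 1.
   An observation table [w : nat -> nat -> X * A] gives
   [w t n] = (x_{t,n}, a_{t,n}). *)

Definition is_dist (R : realType) (S : finType) (q : S -> R) : Prop :=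
  (forall s, 0 <= q s) /\ \sum_s q s = 1.

Definition is_kernel (R : realType) (X A : finType) (N : nat)
    (p : nat -> X * A -> X -> R) : Prop :=
  forall n z, (1 <= n <= N)%N -> is_dist (p n z).

Definition is_policy (R : realType) (X A : finType) (N : nat)
    (pi : nat -> X -> A -> R) : Prop :=
  forall n x, (1 <= n <= N)%N -> is_dist (pi n x).

Definition norm1 (R : realType) (S : finType) (v : S -> R) : R :=
  \sum_s `|v s|.

Definition dotp (R : realType) (S : finType) (N : nat)
    (u v : nat -> S -> R) : R :=
  \sum_(0 <= n < N.+1) \sum_s u n s * v n s.

(* mu^{pi,nu}_n under the kernel p *)
Fixpoint occ (R : realType) (X A : finType) (p : nat -> X * A -> X -> R)
    (pi : nat -> X -> A -> R) (nu : X * A -> R) (n : nat) : X * A -> R :=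
  match n with
  | 0 => nu
  | m.+1 => fun z => \sum_z' occ p pi nu m z' * p m.+1 z' z.1 * pi m.+1 z.1 z.2
  end.

(* nu P_pi *)
Definition push (R : realType) (X A : finType) (N : nat)
    (p : nat -> X * A -> X -> R) (pi : nat -> X -> A -> R)
    (nu : X * A -> R) : X * A -> R := occ p pi nu N.

Definition periodic_policy (R : realType) (X A : finType) (N : nat)
    (p : nat -> X * A -> X -> R) (rho : X * A -> R)
    (pi : nat -> X -> A -> R) : Prop :=
  is_policy N pi /\ push N p pi rho = rho.

(* M_nu^q *)
Definition occ_set (R : realType) (X A : finType) (N : nat)
    (q : nat -> X * A -> X -> R) (nu : X * A -> R)
    (mu : nat -> X * A -> R) : Prop :=
  [/\ forall n, (n <= N)%N -> is_dist (mu n),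
      mu 0%N = nu
    & forall n x, (n < N)%N ->
        \sum_a mu n.+1 (x, a) = \sum_z mu n z * q n.+1 z x].

Definition induces (R : realType) (X A : finType) (N : nat)
    (pi : nat -> X -> A -> R) (mu : nat -> X * A -> R) : Prop :=
  is_policy N pi /\
  forall n x a, (1 <= n <= N)%N -> \sum_a' mu n (x, a') != 0 ->
    pi n x a = mu n (x, a) / \sum_a' mu n (x, a').

(* rho_t for t >= 1; the value at 0 is junk *)
Fixpoint rho_seq (R : realType) (X A : finType) (N : nat)
    (p : nat -> X * A -> X -> R) (rho : X * A -> R)
    (pi : nat -> nat -> X -> A -> R) (t : nat) : X * A -> R :=
  match t with
  | s.+1 => if s == 0%N then rho else push N p (pi s) (rho_seq N p rho pi s)
  | 0 => rho
  end.

(* probability of the trajectory z_0, ..., z_N from nu under pi and p *)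
Definition traj_prob (R : realType) (X A : finType) (N : nat)
    (p : nat -> X * A -> X -> R) (pi : nat -> X -> A -> R)
    (nu : X * A -> R) (z : nat -> X * A) : R :=
  nu (z 0%N) *
  \prod_(0 <= n < N) (p n.+1 (z n) (z n.+1).1 * pi n.+1 (z n.+1).1 (z n.+1).2).

Definition same_past (S : Type) (N t : nat) (w w' : nat -> nat -> S) : Prop :=
  forall s n, (1 <= s < t)%N -> (n <= N)%N -> w s n = w' s n.

(* The trajectories are the random variables [W om t n], 1 <= t <= T.  The past
   of episode t is the sigma-algebra of the finitely-valued variables W_1, ...,
   W_{t-1}, so measurability with respect to it is factorisation through them.
   The objective of episode t may depend on what has been observed up to the
   end of episode t; oblivious objectives are the case of a constant [f]. *)
Record interaction (R : realType) (X A : finType) (N T : nat)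
    (p : nat -> X * A -> X -> R) (rho : X * A -> R)
    (d : measure_display) (Omega : measurableType d) (P : probability Omega R)
    (W : Omega -> nat -> nat -> X * A)
    (f : Omega -> nat -> nat -> (X * A -> R) -> R)
    (pi : Omega -> nat -> nat -> X -> A -> R) : Prop := {
  obs_measurable : forall t n z, (1 <= t <= T)%N -> (n <= N)%N ->
    measurable [set om | W om t n = z];
  policy_past : forall t om om', (1 <= t <= T)%N ->
    same_past N t (W om) (W om') -> pi om t = pi om' t;
  objective_past : forall t om om', (1 <= t <= T)%N ->
    same_past N t.+1 (W om) (W om') -> f om t = f om' t;
  trajectory_law : forall t om0 (z : nat -> X * A), (1 <= t <= T)%N ->
    P [set om | same_past N t (W om) (W om0) /\
                forall n, (n <= N)%N -> W om t n = z n] =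
    (P [set om | same_past N t (W om) (W om0)] *
     (traj_prob N p (pi om0 t) (rho_seq N p rho (pi om0) t) z)%:E)%E
}.

Definition visits (X A : finType) (w : nat -> nat -> X * A) (t n : nat)
    (z : X * A) : nat :=
  (\sum_(1 <= s < t) (w s n == z))%N.

Definition trans_visits (X A : finType) (w : nat -> nat -> X * A) (t n : nat)
    (z : X * A) (x' : X) : nat :=
  (\sum_(1 <= s < t) ((w s n == z) && ((w s n.+1).1 == x')))%N.

(* [phat R w t n] estimates p_n, n >= 1, from the transitions (n-1) -> n *)
Definition phat (R : realType) (X A : finType) (w : nat -> nat -> X * A)
    (t n : nat) (z : X * A) (x' : X) : R :=
  if visits w t n.-1 z == 0%N then #|X|%:R^-1
  else (trans_visits w t n.-1 z x')%:R / (maxn 1 (visits w t n.-1 z))%:R.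

Definition logterm (R : realType) (X A : finType) (N T : nat) (delta : R) : R :=
  ln (#|X|%:R * #|A|%:R * N%:R * T%:R / delta).

Definition Cdelta (R : realType) (X A : finType) (N T : nat) (delta : R) : R :=
  Num.sqrt (2 * #|X|%:R * logterm X A N T delta).

Definition bonus (R : realType) (X A : finType) (N T : nat) (delta : R)
    (w : nat -> nat -> X * A) (t n : nat) (z : X * A) : R :=
  if (n < N)%N
  then Cdelta X A N T delta / Num.sqrt (maxn 1 (visits w t n z))%:R else 0.

Definition bonus_bar (R : realType) (X A : finType) (N T : nat) (l delta : R)
    (w : nat -> nat -> X * A) (t n : nat) (z : X * A) : R :=
  if (n < N)%N
  then l * (N - n)%:R * Cdelta X A N T delta /
       Num.sqrt (maxn 1 (visits w t n z))%:R
  else 0.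

Inductive divergence : Type := KL | Gamma.

Definition psi (R : realType) (X A : finType) (N : nat) (dv : divergence)
    (mu : nat -> X * A -> R) : R :=
  match dv with
  | KL => \sum_(0 <= n < N.+1) \sum_z mu n z * ln (mu n z)
  | Gamma =>
      \sum_(1 <= n < N.+1) \sum_z
        mu n z * ln (mu n z / \sum_a mu n (z.1, a)) +
      \sum_z mu 0%N z * ln (mu 0%N z)
  end.

(* The gradient of [psi] at [mu], pi being the policy attached to mu.  It is
   extended-valued, with log 0 = -oo.  For [Gamma] and n >= 1 the partial
   derivative of sum_a mu(x,a) log(mu(x,a)/sum_a' mu(x,a')) is log pi(a|x). *)
Definition grad_psi (R : realType) (X A : finType) (dv : divergence)
    (mu : nat -> X * A -> R) (pi : nat -> X -> A -> R)
    (n : nat) (z : X * A) : \bar R :=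
  match dv with
  | KL => (lne (mu n z)%:E + 1)%E
  | Gamma => if n == 0%N then (lne (mu 0%N z)%:E + 1)%E
             else lne (pi n z.1 z.2)%:E
  end.

Definition norm1oo (R : realType) (S : finType) (N : nat)
    (v : nat -> S -> \bar R) : \bar R :=
  (\sum_(0 <= n < N.+1) \big[maxe/0]_s `|v n s|)%E.

(* m log (a / b), with 0 log (_ / _) = 0 and m log (a / 0) = +oo for m > 0 *)
Definition wlog_div (R : realType) (m a b : R) : \bar R :=
  if m == 0 then 0%E else if b == 0 then +oo%E else (m * ln (a / b))%:E.

(* D_psi(mu, mu'); pi' is the policy attached to mu' *)
Definition Dpsi (R : realType) (X A : finType) (N : nat) (dv : divergence)
    (mu mu' : nat -> X * A -> R) (pi' : nat -> X -> A -> R) : \bar R :=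
  match dv with
  | KL => (\sum_(0 <= n < N.+1) \sum_z wlog_div (mu n z) (mu n z) (mu' n z))%E
  | Gamma =>
      (\sum_(1 <= n < N.+1) \sum_z
         wlog_div (mu n z) (mu n z / \sum_a mu n (z.1, a))%R (pi' n z.1 z.2) +
       \sum_z wlog_div (mu 0%N z) (mu 0%N z) (mu' 0%N z))%E
  end.

Definition total_obj (R : realType) (S : finType) (N : nat)
    (f : nat -> (S -> R) -> R) (mu : nat -> S -> R) : R :=
  \sum_(1 <= n < N.+1) f n (mu n).

Definition lipschitz1 (R : realType) (S : finType) (l : R)
    (f : (S -> R) -> R) : Prop :=
  forall u v, `|f u - f v| <= l * norm1 (fun s => u s - v s).

Definition objective_ok (R : realType) (S : finType) (N : nat) (l : R)
    (f : nat -> (S -> R) -> R) : Prop :=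
  forall n, (1 <= n <= N)%N ->
    @convex_function R (S -> R^o) setT (f n) /\ lipschitz1 l (f n).

(* Gateaux gradient, which is the Frechet one for a Lipschitz F *)
Definition is_gradient (R : realType) (S : finType) (N : nat)
    (F : (nat -> S -> R) -> R) (u g : nat -> S -> R) : Prop :=
  forall v : nat -> S -> R,
    is_derive (0 : R) (1 : R) (fun h : R => F (fun n s => u n s + h * v n s) : R)
      (dotp N g v).

Definition is_subgradient (R : realType) (S : finType) (N : nat)
    (F : (nat -> S -> R) -> R) (u g : nat -> S -> R) : Prop :=
  forall v : nat -> S -> R,
    F u + dotp N g (fun n s => v n s - u n s) <= F v.

(* The objectives are only convex: nabla F(u) is the gradient if F is
   differentiable at u, and any subgradient otherwise. *)
Definition is_nabla (R : realType) (S : finType) (N : nat)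
    (F : (nat -> S -> R) -> R) (u g : nat -> S -> R) : Prop :=
  is_gradient N F u g \/
  (~ (exists g', is_gradient N F u g') /\ is_subgradient N F u g).

(* feasible set of the optimisation problem producing mu_t *)
Definition feasible (R : realType) (X A : finType) (N T : nat)
    (abar delta : R) (p : nat -> X * A -> X -> R) (rho : X * A -> R)
    (w : nat -> nat -> X * A) (pi : nat -> nat -> X -> A -> R) (t : nat)
    (mu : nat -> X * A -> R) : Prop :=
  occ_set N (@phat R X A w t) (rho_seq N p rho pi t) mu /\
  norm1 (fun z => mu N z - rho z) <=
    dotp N mu (bonus N T delta w t) +
    abar * norm1 (fun z => rho_seq N p rho pi t z - rho z).

Definition step_obj (R : realType) (X A : finType) (N T : nat)
    (dv : divergence) (eta l delta : R) (w : nat -> nat -> X * A) (t : nat)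
    (g mut : nat -> X * A -> R) (pit : nat -> X -> A -> R)
    (mu : nat -> X * A -> R) : \bar R :=
  ((eta * dotp N (fun n z => g n z - bonus_bar N T l delta w t n z) mu)%:E +
   Dpsi N dv mu mut pit)%E.

(* A run along one sample path; [g t] is l_t.  When the sampled data make the
   feasible set empty there is nothing to minimise, and mu_{t+1} is then any
   element of M_{t+1}. *)
Record mdpp_k (R : realType) (X A : finType) (N T : nat) (dv : divergence)
    (eta abar l delta : R) (p : nat -> X * A -> X -> R) (rho : X * A -> R)
    (w : nat -> nat -> X * A) (f : nat -> nat -> (X * A -> R) -> R)
    (pi : nat -> nat -> X -> A -> R) (mu g : nat -> nat -> X * A -> R)
    : Prop := {
  run_start : is_policy N (pi 1%N) /\
    forall n, (n <= N)%N -> mu 1%N n = occ (@phat R X A w 1) (pi 1%N) rho n;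
  run_nabla : forall t, (1 <= t <= T)%N ->
    is_nabla N (total_obj N (f t)) (mu t) (g t);
  run_induced : forall t, (1 <= t < T)%N ->
    occ_set N (@phat R X A w t.+1) (rho_seq N p rho pi t.+1) (mu t.+1) /\
    induces N (pi t.+1) (mu t.+1);
  run_argmin : forall t, (1 <= t < T)%N ->
    (exists m, feasible N T abar delta p rho w pi t.+1 m) ->
    feasible N T abar delta p rho w pi t.+1 (mu t.+1) /\
    forall m, feasible N T abar delta p rho w pi t.+1 m ->
      (step_obj N T dv eta l delta w t (g t) (mu t) (pi t) (mu t.+1) <=
       step_obj N T dv eta l delta w t (g t) (mu t) (pi t) m)%E
}.

Definition regret (R : realType) (X A : finType) (N T : nat) (gamma : R)
    (p : nat -> X * A -> X -> R) (rho : X * A -> R)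
    (f : nat -> nat -> (X * A -> R) -> R) (pi : nat -> nat -> X -> A -> R)
    (pis : nat -> X -> A -> R) : R :=
  \sum_(1 <= t < T.+1)
    (total_obj N (f t) (occ p (pi t) (rho_seq N p rho pi t)) -
     total_obj N (f t) (occ p pis rho)) +
  gamma * \sum_(1 <= t < T.+1) norm1 (fun z => rho_seq N p rho pi t z - rho z).

Definition rate (R : realType) (X A : finType) (N T : nat)
    (alpha l Psi : R) : R :=
  l * N%:R ^+ 3 * #|X|%:R `^ (5 / 4) * #|A|%:R `^ (1 / 4) *
    Num.sqrt (Psi * (1 - alpha)^-1) * T%:R `^ (3 / 4) +
  (1 - alpha)^-1 * l * N%:R ^+ 4 * #|X|%:R ^+ 2 * Num.sqrt (#|A|%:R * T%:R).

(* Main.v *)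
Require Import Defs.
From HB Require Import structures.
From mathcomp Require Import all_boot all_order all_algebra.
From mathcomp Require Import all_classical all_reals all_analysis.
From mathcomp Require Import ring lra zify.

Set Implicit Arguments.
Unset Strict Implicit.
Unset Printing Implicit Defensive.

Import Order.TTheory GRing.Theory Num.Theory.

Local Open Scope classical_set_scope.
Local Open Scope ring_scope.

(* Comparator: nu_t is the flow of the periodic policy pi under the estimated kernel
   from rho_t.  When the estimated kernels are within their confidence radii, the
   contraction of P_pi makes nu_t feasible in episode t, so mu_{t+1} minimises over a
   set containing nu_{t+1}.  The bonus subtracted from the loss pays for evaluating
   pi under the wrong kernel, and the constraint on mu_N gives
   |rho_{t+1} - rho| <= alpha |rho_t - rho| + O(<mu_t, b_t>), so that the sum of
   |rho_t - rho|, and with it the total drift of nu_t, is of order sqrt T up to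
   logarithms.  Mirror descent against a drifting comparator then costs
   (Psi * drift) / eta + eta T, that is T^(3/4) for eta = T^(-1/4).  Only this power
   of T matters: the threshold on T turns any constant depending on the other
   parameters into one more logarithm.

   Probability: the event depends on finitely many discrete observations, so all
   expectations are finite sums.  The sum of the bonuses is controlled by Markov's
   inequality, and the estimated kernels by an exponential supermartingale that counts
   only the first k visits of a state-action pair, with a union bound over k and over
   the sign vectors testing the l1 distance. *)

(** * Occupancy measures and empirical kernels *)

(** Optimality of [mu_{t+1}] is therefore expressed through the potentials [logref] and tested at
    the moving comparator, and the motion of the polytopes is measured by [drift]. Both divergences
    are relative entropies with respect to a reference law [base]. Pinsker's inequality controls the
    distance from [mu_{t+1}] to [base]; for [Gamma] this is a change of policy at the marginals of
    [mu_{t+1}], turned into a distance between flows by induction on time. Bonuses can be summed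
    only under the true flow, the one that is sampled. The single bonus term left under the
    comparator is the one that [bonus_bar] cancels. Markov's inequality costs a factor [1/delta],
    which is harmless because [delta] is fixed before the threshold on [T] is chosen. *)

Definition l1dist (R : realType) (S : finType) (u v : S -> R) : R :=
  norm1 (fun s => u s - v s).

Section Norm1.
Context (R : realType) (S : finType).
Implicit Types u v w : S -> R.

Lemma norm1_ge0 u : 0 <= norm1 u.
Proof. exact: sumr_ge0. Qed.

Lemma l1dist_ge0 u v : 0 <= l1dist u v.
Proof. exact: norm1_ge0. Qed.

Lemma l1distxx u : l1dist u u = 0.
Proof. by rewrite /l1dist /norm1 big1 // => s _; rewrite subrr normr0. Qed.

Lemma l1distC u v : l1dist u v = l1dist v u.
Proof. by apply: eq_bigr => s _; rewrite distrC. Qed.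

Lemma l1dist_triangle v u w : l1dist u w <= l1dist u v + l1dist v w.
Proof.
by rewrite /l1dist /norm1 -big_split ler_sum // => s _; rewrite ler_distD.
Qed.

Lemma norm1_dist u : is_dist u -> norm1 u = 1.
Proof. by case=> u0 <-; apply: eq_bigr => s _; rewrite ger0_norm. Qed.

Lemma l1dist_le2 u v : is_dist u -> is_dist v -> l1dist u v <= 2.
Proof.
move=> du dv; have -> : 2 = norm1 u + norm1 v :> R.
  by rewrite !norm1_dist.
by rewrite /l1dist /norm1 -big_split ler_sum // => s _; rewrite ler_normB.
Qed.

Lemma dist_card u : is_dist u -> (0 < #|S|)%N.
Proof.
case=> _ u1; rewrite lt0n; apply/eqP => /card0_eq e; move/eqP: u1.
rewrite big1 ?(eq_sym 0) ?oner_eq0 // => s _.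
by have := e s; rewrite inE.
Qed.

Lemma dist_le1 u s : is_dist u -> u s <= 1.
Proof.
by case=> u0 <-; rewrite (bigD1 s) //= lerDl sumr_ge0.
Qed.

Lemma is_dist_conv u v (h : R) : 0 <= h <= 1 -> is_dist u -> is_dist v ->
  is_dist (fun s => (1 - h) * u s + h * v s).
Proof.
case/andP=> h0 h1 [u0 u1] [v0 v1]; split=> [s|].
  by rewrite addr_ge0 // mulr_ge0 // subr_ge0.
by rewrite big_split /= -!mulr_sumr u1 v1 !mulr1 subrK.
Qed.

Lemma sum_weight_le (m : S -> R) u (c : R) : is_dist m ->
  (forall s, u s <= c) -> \sum_s m s * u s <= c.
Proof.
move=> [m0 m1] uc; rewrite -[leRHS]mul1r -m1 mulr_suml ler_sum // => s _.
by rewrite ler_wpM2l.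
Qed.

Lemma ler_weight_l1dist (m m' : S -> R) u (c : R) :
  (forall s, 0 <= u s <= c) ->
  \sum_s m s * u s <= \sum_s m' s * u s + c * l1dist m m'.
Proof.
move=> uc; rewrite /l1dist /norm1 mulr_sumr -big_split ler_sum // => s _.
have /andP[u0 us] := uc s; rewrite -lerBlDl -mulrBl.
apply: le_trans (ler_norm _) _; rewrite normrM (ger0_norm u0) mulrC.
by rewrite ler_wpM2r.
Qed.

End Norm1.

Lemma sum_pair (R : realType) (X A : finType) (F : X * A -> R) :
  \sum_z F z = \sum_x \sum_a F (x, a).
Proof. by rewrite pair_bigA /=; apply: eq_bigr => -[x a]. Qed.

Definition next (R : realType) (X A : finType) (p : X * A -> X -> R)
    (pi : X -> A -> R) (m : X * A -> R) : X * A -> R :=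
  fun z => \sum_z' m z' * p z' z.1 * pi z.1 z.2.

Section Flow.
Context (R : realType) (X A : finType).
Implicit Types (p q : X * A -> X -> R) (pi : X -> A -> R) (m : X * A -> R).

Lemma nextE p pi m x a : next p pi m (x, a) = (\sum_z m z * p z x) * pi x a.
Proof. by rewrite /next mulr_suml. Qed.

Lemma next_marginal p pi m x : is_dist (pi x) ->
  \sum_a next p pi m (x, a) = \sum_z m z * p z x.
Proof.
move=> [_ pi1]; under eq_bigr do rewrite nextE.
by rewrite -mulr_sumr pi1 mulr1.
Qed.

Lemma next_dist p pi m : (forall z, is_dist (p z)) ->
  (forall x, is_dist (pi x)) -> is_dist m -> is_dist (next p pi m).
Proof.
move=> pd pid [m0 m1]; split=> [z|].
  apply: sumr_ge0 => z' _; rewrite !mulr_ge0 //; first exact: (pd _).1.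
  exact: (pid _).1.
rewrite sum_pair; under eq_bigr => x _ do rewrite next_marginal //.
rewrite exchange_big /= -m1; apply: eq_bigr => z _.
by rewrite -mulr_sumr (pd z).2 mulr1.
Qed.

(** Split [m p - m' q] into [(m - m') p + m' (p - q)]. The policy error is kept as the distance
    between the new law and its own marginal recombined with [pi]: it vanishes when the policies
    agree, and for [Gamma] it is what Pinsker's inequality controls. *)
Lemma next_perturb p q pi pi' m m' : (forall z, is_dist (p z)) ->
  (forall x, is_dist (pi x)) -> (forall x, is_dist (pi' x)) ->
  (forall z, 0 <= m' z) ->
  l1dist (next p pi m) (next q pi' m') <=
  l1dist m m' + \sum_z m' z * l1dist (p z) (q z) +
  \sum_z `|next q pi' m' z - (\sum_a next q pi' m' (z.1, a)) * pi z.1 z.2|.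
Proof.
move=> pd pid pid' m0; pose M x := \sum_z m z * p z x.
pose M' x := \sum_z m' z * q z x.
have -> : l1dist (next p pi m) (next q pi' m') =
    \sum_x \sum_a `|M x * pi x a - M' x * pi' x a|.
  by rewrite /l1dist /norm1 sum_pair; under eq_bigr do
    under eq_bigr do rewrite !nextE.
have MM : \sum_x `|M x - M' x| <= l1dist m m' + \sum_z m' z * l1dist (p z) (q z).
  apply: (@le_trans _ _ (\sum_x \sum_z (`|m z - m' z| * p z x +
      m' z * `|p z x - q z x|))).
    apply: ler_sum => x _; rewrite /M /M' -sumrB.
    apply: le_trans (ler_norm_sum _ _ _) _; apply: ler_sum => z _.
    have -> : m z * p z x - m' z * q z x =
      (m z - m' z) * p z x + m' z * (p z x - q z x) by ring.
    apply: le_trans (ler_normD _ _) _.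
    by rewrite !normrM (ger0_norm (m0 z)) (ger0_norm ((pd z).1 x)).
  rewrite exchange_big /= -big_split /=; apply: ler_sum => z _.
  by rewrite big_split /= -!mulr_sumr (pd z).2 mulr1.
apply: le_trans (lerD MM (lexx _)); rewrite [X in _ + X]sum_pair -big_split /=.
apply: ler_sum => x _.
rewrite next_marginal // -/(M' x) -[X in X + _]mulr1 -(pid x).2 mulr_sumr.
rewrite -big_split /=; apply: ler_sum => a _; rewrite nextE -/(M' x).
rewrite -[pi x a in X in _ <= X + _]ger0_norm ?(pid x).1 // -normrM mulrBl.
by rewrite [X in _ <= _ + X]distrC ler_distD.
Qed.

End Flow.

Section Occupancy.
Context (R : realType) (X A : finType) (N : nat).
Implicit Types (p q : nat -> X * A -> X -> R) (pi : nat -> X -> A -> R).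
Implicit Types (nu : X * A -> R) (mu : nat -> X * A -> R).

Lemma occ_dist p pi nu n : is_kernel N p -> is_policy N pi -> is_dist nu ->
  (n <= N)%N -> is_dist (occ p pi nu n).
Proof.
move=> kp kpi dnu; elim: n => // n IHn nN.
by apply: next_dist => [z|x|]; [exact: kp|exact: kpi|exact/IHn/ltnW].
Qed.

(** The kernel errors are weighted by the second flow alone, so the order of the two flows decides
    which occupancy pays for them. *)
Lemma occ_perturb p q pi nu nu' n : is_kernel N p -> is_kernel N q ->
  is_policy N pi -> is_dist nu' -> (n <= N)%N ->
  l1dist (occ p pi nu n) (occ q pi nu' n) <=
  l1dist nu nu' + \sum_(0 <= m < n) \sum_z occ q pi nu' m z * l1dist (p m.+1 z) (q m.+1 z).
Proof.
move=> kp kq kpi dnu; elim: n => [|n IHn] nN; first by rewrite big_geq ?addr0.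
have dq : is_dist (occ q pi nu' n) by apply: occ_dist => //; exact: ltnW.
have := @next_perturb _ _ _ (p n.+1) (q n.+1) (pi n.+1) (pi n.+1)
  (occ p pi nu n) (occ q pi nu' n).
move=> /(_ (fun z => kp n.+1 z nN) (fun z => kpi n.+1 z nN)
  (fun z => kpi n.+1 z nN) dq.1).
rewrite [X in _ <= _ + X]big1 ?addr0 => [H|[x a] _]; last first.
  by rewrite next_marginal ?nextE ?subrr ?normr0 //; exact: kpi.
rewrite big_nat_recr //= addrA; apply: le_trans H _.
by rewrite lerD2r; exact/IHn/ltnW.
Qed.

Lemma occ_set_occ q pi nu : is_kernel N q -> is_policy N pi -> is_dist nu ->
  occ_set N q nu (occ q pi nu).
Proof.
move=> kq kpi dnu; split=> // [n nN|n x nN]; first exact: occ_dist.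
by rewrite next_marginal //; exact: kpi.
Qed.

(** Where the marginal vanishes the policy is arbitrary, but then every entry over that state is 0,
    so the product form holds everywhere. *)
Lemma inducesE pi mu n x a : induces N pi mu -> (1 <= n <= N)%N ->
  is_dist (mu n) -> mu n (x, a) = (\sum_a' mu n (x, a')) * pi n x a.
Proof.
move=> [_ ind] nN [m0 _].
have [s0|s0] := eqVneq (\sum_a' mu n (x, a')) 0; last first.
  by rewrite ind // mulrCA mulfV // mulr1.
rewrite s0 mul0r; apply/eqP.
have /eqP := s0; rewrite psumr_eq0 => [/allP/(_ a)|//].
by rewrite mem_index_enum => /(_ isT).
Qed.

Lemma induced_occ q pi nu mu n : occ_set N q nu mu -> induces N pi mu ->
  (n <= N)%N -> mu n = occ q pi nu n.
Proof.
move=> [dmu mu0 flow] ind; elim: n => // n IHn nN; apply/funext => -[x a].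
rewrite (inducesE _ _ ind) //; last exact: dmu.
by rewrite flow // IHn 1?ltnW // mulr_suml.
Qed.

End Occupancy.

(** * Visit counts and empirical kernels *)

Section Empirical.
Context (R : realType) (X A : finType) (w : nat -> nat -> X * A).

Lemma visitsS t n z : (0 < t)%N ->
  visits w t.+1 n z = (visits w t n z + (w t n == z))%N.
Proof. by move=> t0; rewrite /visits big_nat_recr. Qed.

Lemma trans_visitsS t n z x : (0 < t)%N ->
  trans_visits w t.+1 n z x =
  (trans_visits w t n z x + ((w t n == z) && ((w t n.+1).1 == x)))%N.
Proof. by move=> t0; rewrite /trans_visits big_nat_recr. Qed.

Lemma visits_le t t' n z : (t <= t')%N -> (visits w t n z <= visits w t' n z)%N.
Proof.
move=> tt; rewrite /visits; have [t1|t1] := leqP t 1; first by rewrite big_geq.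
by rewrite [leqRHS](@big_cat_nat _ _ _ t) ?leq_addr //= ltnW.
Qed.

Lemma visits_leq t n z : (visits w t n z <= t.-1)%N.
Proof.
rewrite -subn1 -[leqRHS]muln1 -sum_nat_const_nat.
by apply: leq_sum => i _; exact: leq_b1.
Qed.

Lemma sum_trans_visits t n z :
  (\sum_x trans_visits w t n z x)%N = visits w t n z.
Proof.
rewrite exchange_big /=; apply: eq_bigr => s _.
have [_|_] := eqVneq (w s n) z; last by rewrite big1.
by rewrite (bigD1 (w s n.+1).1) //= eqxx big1 ?addn0 // => x /negPf; rewrite eq_sym => ->.
Qed.

Lemma phatE t n z x : visits w t n z != 0%N ->
  phat R w t n.+1 z x = (trans_visits w t n z x)%:R / (visits w t n z)%:R.
Proof.
by rewrite /phat /= => v0; rewrite (negPf v0) (maxn_idPr _) // lt0n.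
Qed.

Lemma phat_dist t n z : is_dist (phat R w t n.+1 z).
Proof.
have [v0|v0] := eqVneq (visits w t n z) 0%N.
  split=> [x|]; first by rewrite /phat /= v0 eqxx invr_ge0.
  under eq_bigr do rewrite /phat /= v0 eqxx.
  rewrite sumr_const -[LHS]mulr_natr mulVf // pnatr_eq0.
  by rewrite -lt0n; apply/card_gt0P; exists z.1.
split=> [x|]; first by rewrite phatE // divr_ge0.
under eq_bigr do rewrite phatE //.
by rewrite -mulr_suml -natr_sum sum_trans_visits mulfV // pnatr_eq0.
Qed.

Lemma phat_kernel N t : is_kernel N (phat R w t).
Proof. by case=> // n z _; exact: phat_dist. Qed.

(** After [k] visits a new one moves the empirical law by [1/(k+1)] times a distance at most 2. The
    weaker [1/sqrt k] has the form of the bonuses, so one summation lemma serves both; [maxn 1]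
    covers the jump away from the uniform law at the first visit. *)
Lemma phat_drift t n z : (0 < t)%N ->
  l1dist (phat R w t.+1 n.+1 z) (phat R w t n.+1 z) <=
  2 * ((w t n == z)%:R / Num.sqrt (maxn 1 (visits w t n z))%:R).
Proof.
move=> t0; have [wz|wz] := eqVneq (w t n) z; last first.
  rewrite mul0r mulr0.
  have -> : phat R w t.+1 n.+1 z = phat R w t n.+1 z; last by rewrite l1distxx.
  apply/funext => x; rewrite /phat /= visitsS // trans_visitsS // (negPf wz).
  by rewrite !addn0.
have [v0|v0] := eqVneq (visits w t n z) 0%N.
  rewrite v0 sqrtr1 divr1 mulr1; apply: l1dist_le2; exact: phat_dist.
set k := visits w t n z in v0 *.
have k0 : 0 < k%:R :> R by rewrite ltr0n lt0n.
have kS : visits w t.+1 n z = k.+1 by rewrite visitsS // wz eqxx addn1.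
pose e x : R := ((w t n.+1).1 == x)%:R.
have de : is_dist e.
  split=> [x|]; first exact: ler0n.
  rewrite (bigD1 (w t n.+1).1) //= /e eqxx big1 ?addr0 // => x /negPf.
  by rewrite eq_sym => ->.
have -> : l1dist (phat R w t.+1 n.+1 z) (phat R w t n.+1 z) =
    k.+1%:R^-1 * l1dist e (phat R w t n.+1 z).
  rewrite /l1dist /norm1 mulr_sumr; apply: eq_bigr => x _.
  rewrite !phatE ?kS // trans_visitsS // wz eqxx /= -/k natrD -/(e x).
  rewrite -[X in _ = X * _](@ger0_norm _ k.+1%:R^-1) ?invr_ge0 // -normrM.
  congr `| _ |; rewrite -natr1.
  have k1 : k%:R + 1 != 0 :> R by rewrite natr1 pnatr_eq0.
  move: (lt0r_neq0 k0) k1; move: (k%:R : R) (e x).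
  move: ((trans_visits w t n z x)%:R : R) => M K E K0 K1; field.
  by rewrite K0 K1.
rewrite mulrC ler_pM ?l1dist_ge0 ?invr_ge0 //.
  by apply: l1dist_le2 => //; exact: phat_dist.
rewrite (maxn_idPr _) ?lt0n // mul1r lef_pV2 ?posrE ?sqrtr_gt0 //.
rewrite -[leRHS]ger0_norm // -sqrtr_sqr ler_wsqrtr //.
rewrite -natrX ler_nat; nia.
Qed.

(** Induction on the number of visits: [1/sqrt k <= 3 (sqrt (k+1) - sqrt k)] amounts to
    [sqrt (k+1) <= 2 sqrt k]. The constant is 3 instead of the usual 2 because the root is taken
    before the visit is counted. *)
Lemma sum_visit_sqrt t n z : (0 < t)%N ->
  \sum_(1 <= s < t) (w s n == z)%:R / Num.sqrt (maxn 1 (visits w s n z))%:R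
  <= 3 * Num.sqrt (visits w t n z)%:R :> R.
Proof.
case: t => // t _; elim: t => [|t IHt]; first by rewrite big_geq ?mulr_ge0 ?sqrtr_ge0.
rewrite big_nat_recr //= (@visitsS t.+1) //.
have [wz|wz] := eqVneq (w t.+1 n) z; last by rewrite /= addn0 mul0r addr0.
apply: le_trans (lerD IHt (lexx _)) _; rewrite /= addn1 mul1r.
case: (visits w t.+1 n z) => [|k].
  by rewrite sqrtr0 mulr0 add0r sqrtr1 invr1 mulr1 ler1n.
rewrite (maxn_idPr _) //.
set a := Num.sqrt k.+1%:R; set b := Num.sqrt k.+2%:R.
have a2 : a ^+ 2 = k.+1%:R by rewrite sqr_sqrtr.
have b2 : b ^+ 2 = k.+2%:R by rewrite sqr_sqrtr.
have a0 : 0 < a by rewrite sqrtr_gt0 ltr0n.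
have b0 : 0 < b by rewrite sqrtr_gt0 ltr0n.
have ab : b <= 2 * a.
  rewrite -(@ler_pXn2r _ 2) ?nnegrE ?mulr_ge0 // ?ltW // exprMn a2 b2.
  have : 1 <= k.+1%:R :> R by rewrite ler1n.
  by rewrite -[k.+2%:R]natr1; lra.
have E : (b - a) * (b + a) = 1.
  by rewrite -subr_sqr a2 b2 -[k.+2%:R]natr1 addrAC subrr add0r.
have H : b - a = (b + a)^-1.
  by apply: (@mulIf _ (b + a)); rewrite ?E ?mulVf // gt_eqF // addr_gt0.
rewrite -lerBrDl -mulrBr H ler_pdivlMr ?addr_gt0 // mulrC ler_pdivrMr //; lra.
Qed.

Lemma sum_visit_sqrt_le N t T : (0 < t <= T.+1)%N ->
  \sum_(0 <= n < N) \sum_z \sum_(1 <= s < t)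
    (w s n == z)%:R / Num.sqrt (maxn 1 (visits w s n z))%:R
  <= 3 * N%:R * #|{: X * A}|%:R * Num.sqrt T%:R :> R.
Proof.
case/andP=> t0 tT.
apply: (@le_trans _ _ (\sum_(0 <= n < N) \sum_(z : X * A) (3 * Num.sqrt T%:R))).
  apply: ler_sum => n _; apply: ler_sum => z _.
  apply: le_trans (sum_visit_sqrt _ _ t0) _; rewrite ler_wpM2l //.
  rewrite ler_wsqrtr // ler_nat (leq_trans (visits_leq _ _ _)) //.
  by rewrite -ltnS prednK.
under eq_bigr do rewrite sumr_const.
rewrite sumr_const_nat subn0 -[leLHS]mulr_natr -[X in X * _ <= _]mulr_natr.
by lra.
Qed.

End Empirical.

(** * Relative entropy and the mirror step *)

Definition kl_term (R : realType) (u v : R) : R := u * ln (u / v).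

Section Entropy.
Context (R : realType).
Implicit Types u v a : R.

Lemma ln_le_subr1 (x : R) : 0 < x -> ln x <= x - 1.
Proof.
by move=> x0; rewrite -{1}(subrKC 1 x) le_ln1Dx //; lra.
Qed.

Lemma kl_term0 v : kl_term 0 v = 0.
Proof. by rewrite /kl_term mul0r. Qed.

Lemma kl_termxx u : kl_term u u = 0.
Proof.
have [->|u0] := eqVneq u 0; first by rewrite kl_term0.
by rewrite /kl_term divff // ln1 mulr0.
Qed.

(* A pointwise form of: relative entropy dominates the squared Hellinger
   distance. *)
Lemma kl_term_ge u v : 0 <= u -> 0 <= v -> (v = 0 -> u = 0) ->
  u - v + (Num.sqrt u - Num.sqrt v) ^+ 2 <= kl_term u v.
Proof.
move=> u0 v0 vu; have [->|un0] := eqVneq u 0.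
  by rewrite kl_term0 sqrtr0 !sub0r sqrrN sqr_sqrtr // addNr.
have vn0 : v != 0 by apply: contra_neq un0.
have su : 0 < Num.sqrt u by rewrite sqrtr_gt0 lt0r un0.
have sv : 0 < Num.sqrt v by rewrite sqrtr_gt0 lt0r vn0.
have Eu := sqr_sqrtr u0; have Ev := sqr_sqrtr v0.
move: su sv Eu Ev; rewrite /kl_term.
move: (Num.sqrt u) (Num.sqrt v) => a b a0 b0 ua vb; rewrite -ua -vb.
have -> : a ^+ 2 / b ^+ 2 = ((b / a) ^+ 2)^-1.
  by rewrite expr_div_n invf_div.
have ba : 0 < b / a by rewrite divr_gt0.
rewrite lnV ?posrE ?exprn_gt0 // lnXn //.
have := ln_le_subr1 ba; rewrite -(ler_pM2l (exprn_gt0 2 a0)).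
have -> : a ^+ 2 * (b / a - 1) = a * b - a ^+ 2 by field; rewrite gt_eqF.
by move=> H; lra.
Qed.

(** Chi-square bound, from [ln x <= x - 1]. *)
Lemma kl_term_le u v : 0 <= u -> 0 <= v -> (v = 0 -> u = 0) ->
  kl_term u v <= u - v + (u - v) ^+ 2 / v.
Proof.
move=> u0 v0 vu; have [ve0|vn0] := eqVneq v 0.
  by rewrite vu // ve0 kl_term0 subrr expr0n /= mul0r addr0.
have [->|un0] := eqVneq u 0.
  rewrite kl_term0 !sub0r sqrrN expr2 -mulrA divff // mulr1; lra.
have uv : 0 < u / v by rewrite divr_gt0 // lt0r ?un0 ?vn0.
have -> : u - v + (u - v) ^+ 2 / v = u * (u / v - 1) by field.
by rewrite ler_wpM2l // ln_le_subr1.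
Qed.

Context (S : finType).
Implicit Types x y : S -> R.

(* AM-GM: [a |u - v| = a |sqrt u - sqrt v| (sqrt u + sqrt v)
   <= (sqrt u - sqrt v)^2 + a^2 (sqrt u + sqrt v)^2 / 4]. *)
Lemma kl_term_pinsker x y a : is_dist x -> is_dist y ->
  (forall s, y s = 0 -> x s = 0) -> a * l1dist x y <= a ^+ 2 + \sum_s kl_term (x s) (y s).
Proof.
move=> [x0 x1] [y0 y1] yx.
have -> : a ^+ 2 + \sum_s kl_term (x s) (y s) =
    \sum_s (kl_term (x s) (y s) - (x s - y s) + a ^+ 2 / 2 * (x s + y s)).
  rewrite !big_split /= -mulr_sumr big_split /= sumrN big_split /= sumrN x1 y1.
  by field.
rewrite /l1dist /norm1 mulr_sumr; apply: ler_sum => s _.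
have := kl_term_ge (x0 s) (y0 s) (yx s).
have sx := sqrtr_ge0 (x s); have sy := sqrtr_ge0 (y s).
have := sqr_sqrtr (x0 s); have := sqr_sqrtr (y0 s).
move: (kl_term _ _) => K; move: sx sy.
move: (Num.sqrt (x s)) (Num.sqrt (y s)) => p q p0 q0 <- <- H.
have -> : p ^+ 2 - q ^+ 2 = (p - q) * (p + q) by ring.
rewrite normrM (ger0_norm (addr_ge0 p0 q0)).
have : `|p - q| ^+ 2 = (p - q) ^+ 2 by rewrite real_normK // num_real.
move: (`|p - q|) => e e2.
have := sqr_ge0 (e - a * (p + q) / 2); have := mulr_ge0 (sqr_ge0 a) (sqr_ge0 (p - q)).
rewrite -e2 in H *; nra.
Qed.

End Entropy.

(** * Common treatment of the two divergences *)

Section Divergence.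
Context (R : realType) (X A : finType) (N : nat) (dv : divergence).
Implicit Types (m mu nu : nat -> X * A -> R) (pi : nat -> X -> A -> R).

(* For both divergences [Dpsi] is, time by time, the relative entropy of m with
   respect to this law. *)
Definition base mu pi m (n : nat) (z : X * A) : R :=
  match dv with
  | KL => mu n z
  | Gamma => if n == 0%N then mu 0%N z
             else (\sum_a m n (z.1, a)) * pi n z.1 z.2
  end.

(* [grad_psi] up to an additive constant *)
Definition logref mu pi (n : nat) (z : X * A) : R :=
  match dv with
  | KL => ln (mu n z)
  | Gamma => if n == 0%N then ln (mu 0%N z) else ln (pi n z.1 z.2)
  end.

(** What a finite gradient of [psi] provides. For [Gamma], laws at later times may still vanish over
    states that are not reached. *)
Definition positive mu pi : Prop := forall n z, (n <= N)%N ->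
  match dv with
  | KL => 0 < mu n z
  | Gamma => if n == 0%N then 0 < mu 0%N z else 0 < pi n z.1 z.2
  end.

Definition rDpsi m mu pi : R :=
  \sum_(0 <= n < N.+1) \sum_z kl_term (m n z) (base mu pi m n z).

Lemma marginal_eq0 m n z : (forall z', 0 <= m n z') ->
  \sum_a m n (z.1, a) = 0 -> m n z = 0.
Proof.
case: z => x a /= m0 s0; apply/eqP; move/eqP: s0; rewrite psumr_eq0 => [/allP/(_ a)|//].
by rewrite mem_index_enum => /(_ isT).
Qed.

Lemma marginal_gt0 m n z : (forall z', 0 <= m n z') -> 0 < m n z ->
  0 < \sum_a m n (z.1, a).
Proof.
move=> m0 mz; rewrite lt0r sumr_ge0 // andbT.
by apply: contraTneq mz => /(marginal_eq0 m0) ->; rewrite ltxx.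
Qed.

Lemma DpsiE m mu pi : positive mu pi ->
  (forall n z, (n <= N)%N -> 0 <= m n z) ->
  Dpsi N dv m mu pi = (rDpsi m mu pi)%:E.
Proof.
rewrite /Dpsi /rDpsi /base /positive; case: dv => [] pos m0.
  rewrite -sumEFin !big_nat; apply: eq_bigr => n nN; rewrite -sumEFin.
  apply: eq_bigr => z _; rewrite /wlog_div.
  have [->|_] := eqVneq (m n z) 0; first by rewrite kl_term0.
  by rewrite gt_eqF // pos.
rewrite [in RHS]big_ltn // [in RHS]addrC EFinD -!sumEFin; congr (_ + _)%E; last first.
  apply: eq_bigr => z _; rewrite /wlog_div.
  have [->|_] := eqVneq (m 0%N z) 0; first by rewrite kl_term0.
  by have /= p0 := pos 0%N z isT; rewrite gt_eqF.
rewrite !big_nat; apply: eq_bigr => n /andP[n1 nN]; rewrite -sumEFin.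
apply: eq_bigr => z _; rewrite /wlog_div.
have [->|_] := eqVneq (m n z) 0; first by rewrite kl_term0.
have := pos n z nN; rewrite -(prednK n1) /= => p0.
by rewrite gt_eqF // /kl_term invfM mulrA.
Qed.

(** The entropy of [m] (for [Gamma], of its conditional laws) cancels, so two references differ by a
    term linear in [m]. This replaces the three-point identity of Bregman divergences. *)
Lemma rDpsi_diff m mu pi mu' pi' : positive mu pi -> positive mu' pi' ->
  (forall n z, (n <= N)%N -> 0 <= m n z) ->
  rDpsi m mu pi = rDpsi m mu' pi' +
    dotp N m (fun n z => logref mu' pi' n z - logref mu pi n z).
Proof.
move=> pos pos' m0; rewrite /rDpsi /dotp -[RHS]big_split.
rewrite !big_nat; apply: eq_bigr => n /= nN; rewrite -[RHS]big_split.
apply: eq_bigr => z _ /=.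
have [->|mn0] := eqVneq (m n z) 0; first by rewrite !kl_term0 mul0r addr0.
have m0' : 0 < m n z by rewrite lt0r mn0 m0.
move: pos pos'; rewrite /positive /base /logref /kl_term.
case: dv => /(_ n z nN) p0 /(_ n z nN) p0'.
  by rewrite !ln_div ?posrE // -mulrDr; congr (_ * _); ring.
case: ifPn p0 p0' => [/eqP n0|n0] p0 p0'.
  by rewrite !ln_div ?posrE // -mulrDr; congr (_ * _); ring.
have s0 : 0 < \sum_a m n (z.1, a) by apply: marginal_gt0 => // z'; exact: m0.
rewrite !ln_div ?posrE ?mulr_gt0 // !lnM ?posrE //.
by rewrite -mulrDr; congr (_ * _); ring.
Qed.

Lemma base_self mu pi n z : induces N pi mu -> is_dist (mu n) -> (n <= N)%N ->
  base mu pi mu n z = mu n z.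
Proof.
rewrite /base; case: dv => // ind dmu nN; case: ifPn => [/eqP ->//|n0].
by case: z => x a; rewrite [RHS](inducesE _ _ ind) // lt0n n0.
Qed.

Lemma rDpsi_self mu pi : induces N pi mu ->
  (forall n, (n <= N)%N -> is_dist (mu n)) -> rDpsi mu mu pi = 0.
Proof.
move=> ind dmu; rewrite /rDpsi big_nat big1 // => n nN; rewrite big1 // => z _.
by rewrite base_self ?kl_termxx //; exact: dmu.
Qed.

Lemma base_dist mu pi m n : is_policy N pi -> is_dist (mu n) -> is_dist (m n) ->
  (n <= N)%N -> is_dist (base mu pi m n).
Proof.
move=> kpi dmu [m0 m1] nN; rewrite /base; case: dv => //.
have [n00|n0] := eqVneq n 0%N; first by rewrite -n00.
have dpi x : is_dist (pi n x) by apply: kpi; rewrite lt0n n0.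
split=> [z|]; first by rewrite mulr_ge0 ?sumr_ge0 // (dpi _).1.
rewrite sum_pair -m1 sum_pair; apply: eq_bigr => x _ /=.
by rewrite -mulr_sumr (dpi x).2 mulr1.
Qed.

Lemma base_eq0 mu pi m n z : positive mu pi -> (forall z', 0 <= m n z') ->
  (n <= N)%N -> base mu pi m n z = 0 -> m n z = 0.
Proof.
rewrite /positive /base => pos m0 nN; move: pos; case: dv => /(_ n z nN).
  by move=> + E; rewrite E ltxx.
case: ifPn => [_ + E|_ p0 /eqP]; first by rewrite E ltxx.
by rewrite mulf_eq0 (gt_eqF p0) orbF => /eqP; exact: marginal_eq0.
Qed.

(** Pinsker's inequality in linearised form, summed over time; [a] is chosen later so that the left
    side cancels a stability term. *)
Lemma rDpsi_pinsker a m mu pi : positive mu pi -> is_policy N pi ->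
  (forall n, (n <= N)%N -> is_dist (mu n)) ->
  (forall n, (n <= N)%N -> is_dist (m n)) ->
  a * \sum_(0 <= n < N.+1) l1dist (m n) (base mu pi m n) <=
  N.+1%:R * a ^+ 2 + rDpsi m mu pi.
Proof.
move=> pos kpi dmu dm.
have -> : N.+1%:R * a ^+ 2 = \sum_(0 <= n < N.+1) a ^+ 2.
  by rewrite sumr_const_nat subn0 mulr_natl.
rewrite mulr_sumr /rDpsi -[leRHS]big_split !big_nat /=; apply: ler_sum => n nN.
have dn := dm n nN.
apply: kl_term_pinsker => // [|z]; first exact/base_dist/nN/dn/dmu.
by apply: base_eq0 => //; exact: dn.1.
Qed.

(* Off the support of [mu] the Gamma divergence is not differentiable; flows with
   the same kernel and initial law never leave that support. *)
Lemma occ_set_dominated (q : nat -> X * A -> X -> R) (r0 : X * A -> R)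
    mu pi nu n z : positive mu pi -> induces N pi mu ->
  occ_set N q r0 mu -> occ_set N q r0 nu ->
  (forall n z x, (1 <= n <= N)%N -> 0 <= q n z x) ->
  (n <= N)%N -> mu n z = 0 -> nu n z = 0.
Proof.
move=> pos ind [dmu mu0 fmu] [dnu nu0 fnu] q0.
elim: n z => [|n IHn] z nN; first by rewrite mu0 nu0.
move: pos; rewrite /positive; case: dv => /(_ n.+1 z nN) /=.
  by move=> + E; rewrite E ltxx.
case: z => x a /= p0; rewrite (inducesE _ _ ind) //; last exact: dmu.
move=> /eqP; rewrite mulf_eq0 (gt_eqF p0) orbF fmu // psumr_eq0; last first.
  by move=> z _; rewrite mulr_ge0 ?q0 //; apply: (dmu n (ltnW nN)).1.
move=> /allP muq; apply: (@marginal_eq0 nu n.+1 (x, a)).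
  exact: (dnu _ nN).1.
rewrite /= fnu // big1 // => z _.
have /(_ z) := muq; rewrite mem_index_enum => /(_ isT).
rewrite /= mulf_eq0 => /orP[/eqP /(IHn _ (ltnW nN)) ->|/eqP ->].
  by rewrite mul0r.
by rewrite mulr0.
Qed.

Definition mix (h : R) mu nu (n : nat) (z : X * A) : R :=
  (1 - h) * mu n z + h * nu n z.

(** [base] is affine in [m] and fixes [mu]. So the mixture and its [base] differ by [h] times a
    fixed vector, while [base] stays above [mu / 2] for [h <= 1/2]; the chi-square bound is then
    quadratic in [h]. *)
Lemma rDpsi_mix_le mu pi nu : positive mu pi -> induces N pi mu ->
  (forall n, (n <= N)%N -> is_dist (mu n)) ->
  (forall n, (n <= N)%N -> is_dist (nu n)) ->
  (forall n z, (n <= N)%N -> mu n z = 0 -> nu n z = 0) ->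
  exists K : R, 0 <= K /\ forall h, 0 < h <= 1 / 2 ->
    rDpsi (mix h mu nu) mu pi <= K * h ^+ 2.
Proof.
move=> pos ind dmu dnu dom.
exists (\sum_(0 <= n < N.+1) \sum_z
  2 * (nu n z - base mu pi nu n z) ^+ 2 / mu n z); split.
  rewrite big_nat; apply: sumr_ge0 => n nN; apply: sumr_ge0 => z _.
  by rewrite divr_ge0 ?(dmu n nN).1 // mulr_ge0 // sqr_ge0.
move=> h /andP[h0 h2]; rewrite mulr_suml /rDpsi !big_nat; apply: ler_sum => n nN.
have dm : is_dist (mix h mu nu n).
  by apply: is_dist_conv; [lra|exact: dmu|exact: dnu].
have db : is_dist (base mu pi (mix h mu nu) n).
  by apply: base_dist => //; [exact: ind.1|exact: dmu].
have baseE z : mix h mu nu n z - base mu pi (mix h mu nu) n z =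
    h * (nu n z - base mu pi nu n z).
  have := base_self z ind (dmu n nN) nN; rewrite /mix /base; case: dv => [_|].
    by ring.
  case: ifPn => [/eqP -> _|_ E]; first by ring.
  by rewrite big_split /= -!mulr_sumr -[in LHS]E; ring.
have base_ge z : mu n z / 2 <= base mu pi (mix h mu nu) n z.
  have := base_self z ind (dmu n nN) nN; have := (dmu n nN).1 z.
  have [nu0 _] := dnu n nN.
  rewrite /base; case: dv => [mu0 _|mu0]; first by lra.
  case: ifPn mu0 => [/eqP -> mu0 _|n0 mu0 E]; first by lra.
  rewrite big_split /= -!mulr_sumr.
  have p0 : 0 <= pi n z.1 z.2.
    by apply: (ind.1 n z.1 _).1; rewrite lt0n n0.
  have s0 : 0 <= \sum_a nu n (z.1, a) by exact: sumr_ge0.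
  rewrite mulrDl -mulrA E.
  have := mulr_ge0 (mulr_ge0 (ltW h0) s0) p0.
  have : 0 <= (1 / 2 - h) * mu n z by rewrite mulr_ge0 ?subr_ge0.
  lra.
have base0 z : mu n z = 0 -> base mu pi (mix h mu nu) n z = 0.
  move=> mz; move: pos; rewrite /positive /base.
  have := base_self z ind (dmu n nN) nN; rewrite /base.
  case: dv => [//|E /(_ n z nN)]; case: ifPn E => [/eqP <- //|n0 E p0].
  move/eqP: E; rewrite mz mulf_eq0 (gt_eqF p0) orbF => /eqP s0.
  rewrite big1 ?mul0r // => a _.
  have mua : mu n (z.1, a) = 0.
    by apply: marginal_eq0 => //; exact: (dmu n nN).1.
  by rewrite /mix mua dom // !mulr0 addr0.
apply: (@le_trans _ _ (\sum_z (mix h mu nu n z - base mu pi (mix h mu nu) n z +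
    2 * (nu n z - base mu pi nu n z) ^+ 2 / mu n z * h ^+ 2))); last first.
  by rewrite big_split /= sumrB dm.2 db.2 subrr add0r mulr_suml.
apply: ler_sum => z _.
apply: le_trans (kl_term_le (dm.1 z) (db.1 z) (base_eq0 pos dm.1 nN)) _.
rewrite lerD2l baseE.
have [mz|mz] := eqVneq (mu n z) 0.
  by rewrite base0 // mz invr0 !mulr0 mul0r.
have mz0 : 0 < mu n z by rewrite lt0r mz (dmu n nN).1.
have b0 : 0 < base mu pi (mix h mu nu) n z.
  by apply: lt_le_trans (base_ge z); rewrite divr_gt0.
rewrite ler_pdivrMr //.
have -> : (h * (nu n z - base mu pi nu n z)) ^+ 2 =
  2 * (nu n z - base mu pi nu n z) ^+ 2 / mu n z * h ^+ 2 * (mu n z / 2).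
  by field.
rewrite ler_wpM2l // mulr_ge0 ?sqr_ge0 // divr_ge0 ?(ltW mz0) //.
by rewrite mulr_ge0 // sqr_ge0.
Qed.

(* First-order optimality, without differentiating: the quadratic upper bound on
   the divergence makes the linear part nonnegative. *)
Lemma first_order_optimality (eta : R) (G : nat -> X * A -> R) mu pi mu' pi' nu :
  positive mu pi -> positive mu' pi' -> induces N pi mu ->
  (forall n, (n <= N)%N -> is_dist (mu n)) ->
  (forall n, (n <= N)%N -> is_dist (nu n)) ->
  (forall n z, (n <= N)%N -> mu n z = 0 -> nu n z = 0) ->
  (forall h, 0 < h <= 1 ->
     eta * dotp N G mu + rDpsi mu mu' pi' <=
     eta * dotp N G (mix h mu nu) + rDpsi (mix h mu nu) mu' pi') ->
  0 <= dotp N (fun n z => eta * G n z + logref mu pi n z - logref mu' pi' n z)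
         (fun n z => nu n z - mu n z).
Proof.
move=> pos pos' ind dmu dnu dom opt.
have [K [K0 HK]] := rDpsi_mix_le pos ind dmu dnu dom.
set D := dotp N _ _.
have key h : 0 < h <= 1 / 2 -> 0 <= h * D + K * h ^+ 2.
  move=> hh; have h1 : 0 < h <= 1 by lra.
  have mu0 n z : (n <= N)%N -> 0 <= mu n z by move=> nN; exact: (dmu n nN).1.
  have m0 n z : (n <= N)%N -> 0 <= mix h mu nu n z.
    by move=> nN; apply: (is_dist_conv _ (dmu n nN) (dnu n nN)).1; lra.
  have := opt h h1; have := HK h hh.
  (* Changing the reference from [mu'] to [mu] leaves the divergence of the mixture from [mu], at
     most [K h^2], plus terms linear in the displacement. *)
  rewrite (rDpsi_diff pos' pos mu0) (rDpsi_diff pos' pos m0) rDpsi_self // add0r.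
  set r := rDpsi _ _ _; move=> r0 H.
  have -> : h * D = eta * dotp N G (mix h mu nu) - eta * dotp N G mu +
     (dotp N (mix h mu nu) (fun n z => logref mu pi n z - logref mu' pi' n z) -
      dotp N mu (fun n z => logref mu pi n z - logref mu' pi' n z)).
    rewrite /D /dotp !mulr_sumr -!sumrB -big_split /=; apply: eq_bigr => n _.
    rewrite !mulr_sumr -!sumrB -big_split /=; apply: eq_bigr => z _.
    by rewrite /mix; ring.
  lra.
rewrite leNgt; apply/negP => D0.
(* Small enough that [K h < - D], which contradicts [0 <= D + K h]. *)
pose h := Num.min (1 / 2) (- D / (2 * (K + 1))).
have K1 : 0 < 2 * (K + 1) by lra.
have h0 : 0 < h.
  by rewrite lt_min; apply/andP; split; [lra|rewrite divr_gt0 ?oppr_gt0].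
have h2 : h <= 1 / 2 by rewrite ge_min lexx.
have hD : h * (2 * (K + 1)) <= - D by rewrite -ler_pdivlMr // ge_min lexx orbT.
have := key h; rewrite h0 h2 => /(_ isT).
have -> : h * D + K * h ^+ 2 = h * (D + K * h) by ring.
rewrite pmulr_rge0 // => H.
have := mulr_ge0 K0 (ltW h0); lra.
Qed.

End Divergence.

(** * Subgradients of the objectives *)

Section Objective.
Import numFieldNormedType.Exports.
Context (R : realType) (S : finType) (N : nat) (l : R).
Implicit Types (f : nat -> (S -> R) -> R) (u v g : nat -> S -> R).

Lemma total_obj_lip f u v : objective_ok N l f ->
  total_obj N f u - total_obj N f v <= l * \sum_(1 <= n < N.+1) l1dist (u n) (v n).
Proof.
move=> ok; rewrite /total_obj -sumrB mulr_sumr !big_nat; apply: ler_sum => n nN.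
by apply: le_trans (ler_norm _) _; exact: (ok n nN).2.
Qed.

Lemma total_obj_convex f u v (h : R) : objective_ok N l f -> 0 <= h <= 1 ->
  total_obj N f (fun n s => u n s + h * (v n s - u n s)) <=
  (1 - h) * total_obj N f u + h * total_obj N f v.
Proof.
move=> ok /andP[h0 h1].
rewrite /total_obj !mulr_sumr -big_split !big_nat /=; apply: ler_sum => n nN.
have [cvx _] := ok n nN.
have := cvx (Itv01 h0 h1) (v n) (u n); rewrite !inE => /(_ Logic.I Logic.I).
rewrite convRE /= [X in _ <= X]addrC; apply: le_trans.
rewrite le_eqVlt; apply/orP; left; apply/eqP; congr (f n).
apply/funext => s.
have -> : (u n s + h * (v n s - u n s)) = h * v n s + (1 - h) * u n s by ring.
by [].
Qed.

(** By convexity the difference quotients towards [v] with step at most 1 are bounded by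
    [F v - F u], hence so is their limit. *)
Lemma gradient_subgradient f u g : objective_ok N l f ->
  is_gradient N (total_obj N f) u g -> is_subgradient N (total_obj N f) u g.
Proof.
move=> ok grad v; set d := dotp N g _; set F := total_obj N f.
have [] := grad (fun n s => v n s - u n s); rewrite -/d -/F /derivable /derive.
set q := (q in cvg (q @ _)) => dq qd.
have q0 : q h @[h --> (0 : R)^'] --> (d : R) by rewrite -qd.
rewrite -lerBrDl leNgt; apply/negP => dF.
have e0 : 0 < d - (F v - F u) by rewrite subr_gt0.
move/cvgrPdist_lt : q0 => /(_ _ e0) /nbhs_normP[r /= r0 Hr].
pose h := Num.min (r / 2) 1.
have h0 : 0 < h by rewrite lt_min ltr01 divr_gt0.
have h1 : h <= 1 by rewrite ge_min lexx orbT.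
have hr : h < r.
  have : h <= r / 2 by rewrite ge_min lexx.
  by lra.
have := Hr h; rewrite /= sub0r normrN gtr0_norm // => /(_ hr).
rewrite gt_eqF // => /(_ isT).
suff : q h <= F v - F u.
  move=> H; have := ler_norm (d - q h); lra.
rewrite /q /= /GRing.scale /= mulr1 addr0 mulrC ler_pdivrMr //.
have := @total_obj_convex f u v h ok; rewrite h1 ltW // => /(_ isT).
have -> : (fun n s => u n s + 0 * (v n s - u n s)) = u.
  by apply/funext => n; apply/funext => s; rewrite mul0r addr0.
rewrite -/F; lra.
Qed.

Lemma nabla_subgradient f u g : objective_ok N l f ->
  is_nabla N (total_obj N f) u g -> is_subgradient N (total_obj N f) u g.
Proof. by move=> ok [/(gradient_subgradient ok)|[]]. Qed.

(** Test the subgradient inequality at [u] plus or minus a unit vector: a Lipschitz bound in [norm1]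
    is dual to a sup bound on [g]. *)
Lemma subgradient_bound f u g n s : 0 <= l -> objective_ok N l f ->
  is_subgradient N (total_obj N f) u g -> (n <= N)%N -> `|g n s| <= l.
Proof.
move=> l0 ok sub nN.
have key (e : R) : `|e| = 1 -> e * g n s <= l.
  move=> e1; pose D m s' : R := if (m == n) && (s' == s) then e else 0.
  have := sub (fun m s' => u m s' + D m s').
  have -> : (fun m s' => u m s' + D m s' - u m s') = D.
    by apply/funext => m; apply/funext => s'; ring.
  have -> : dotp N g D = e * g n s.
    rewrite /dotp (bigD1_seq n) ?iota_uniq ?mem_index_iota //= (bigD1 s) //=.
    rewrite /D !eqxx /= mulrC.
    rewrite big1 ?addr0 => [|s' /negPf ss]; last by rewrite ss mulr0.
    rewrite big1 ?addr0 // => m /negPf mn; rewrite big1 // => s' _.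
    by rewrite mn mulr0.
  rewrite -lerBrDl => /le_trans; apply.
  apply: le_trans (total_obj_lip _ _ ok) _; rewrite -[leRHS]mulr1 ler_wpM2l //.
  have dE m : l1dist (fun s' => u m s' + D m s') (u m) = norm1 (D m).
    by apply: eq_bigr => s' _; congr `| _ |; ring.
  apply: (@le_trans _ _ (\sum_(0 <= m < N.+1) norm1 (D m))).
    rewrite [leRHS]big_ltn // -[leLHS]add0r lerD ?norm1_ge0 // ler_sum // => m _.
    by rewrite dE.
  rewrite (bigD1_seq n) ?iota_uniq ?mem_index_iota //= big1 => [|m /negPf mn]; last first.
    by rewrite /norm1 big1 // => s' _; rewrite /D mn normr0.
  rewrite addr0 /norm1 (bigD1 s) //= big1 => [|s' /negPf ss]; last first.
    by rewrite /D ss andbF normr0.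
  by rewrite /D !eqxx addr0 e1.
have := key 1; have := key (-1); rewrite normrN normr1 => /(_ erefl) A /(_ erefl) B.
by rewrite ler_norml; lra.
Qed.

End Objective.

(** * Regret along a sample path *)

(** Origin of the factor [N - n] in [bonus_bar]: a kernel error in the transition out of time [m]
    affects each of the [K - m] later laws. *)
Lemma triangular_sum (R : realType) (K : nat) (B : nat -> R) :
  \sum_(1 <= n < K.+1) \sum_(0 <= m < n) B m =
  \sum_(0 <= m < K) (K - m)%:R * B m.
Proof.
elim: K => [|K IHK]; first by rewrite !big_geq.
rewrite big_nat_recr //= IHK [RHS]big_nat_recr //= subSn // subnn mul1r.
rewrite [X in _ + X]big_nat_recr //= addrA; congr (_ + _).
rewrite -big_split !big_nat; apply: eq_bigr => m /= mK.
by rewrite subSn 1?ltnW // -natr1 mulrDl mul1r.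
Qed.

Section Dotp.
Context (R : realType) (S : finType) (N : nat).
Implicit Types (u v : nat -> S -> R).

Lemma dotpC u v : dotp N u v = dotp N v u.
Proof. by apply: eq_bigr => n _; apply: eq_bigr => s _; rewrite mulrC. Qed.

Lemma dotpBr u v v' :
  dotp N u (fun n s => v n s - v' n s) = dotp N u v - dotp N u v'.
Proof.
rewrite /dotp -sumrB; apply: eq_bigr => n _; rewrite -sumrB.
by apply: eq_bigr => s _; rewrite mulrBr.
Qed.

Lemma dotpBl u u' v :
  dotp N (fun n s => u n s - u' n s) v = dotp N u v - dotp N u' v.
Proof. by rewrite dotpC dotpBr !(dotpC v). Qed.

Lemma dotp_ge0 u v : (forall n s, (n <= N)%N -> 0 <= u n s) ->
  (forall n s, (n <= N)%N -> 0 <= v n s) -> 0 <= dotp N u v.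
Proof.
move=> u0 v0; rewrite /dotp big_nat; apply: sumr_ge0 => n nN.
by apply: sumr_ge0 => s _; rewrite mulr_ge0 ?u0 ?v0.
Qed.

Lemma dotp_le_l1dist u v v' (c : R) : (forall n s, (n <= N)%N -> `|u n s| <= c) ->
  dotp N u (fun n s => v n s - v' n s) <=
  c * \sum_(0 <= n < N.+1) l1dist (v n) (v' n).
Proof.
move=> uc; rewrite /dotp mulr_sumr !big_nat; apply: ler_sum => n nN.
rewrite /l1dist /norm1 mulr_sumr; apply: ler_sum => s _.
by apply: le_trans (ler_norm _) _; rewrite normrM ler_wpM2r // uc.
Qed.

Lemma dotp_le_dist u v (c : R) : (forall n s, (n <= N)%N -> `|u n s| <= c) ->
  (forall n, (n <= N)%N -> is_dist (v n)) -> `|dotp N u v| <= N.+1%:R * c.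
Proof.
move=> uc dv; apply: le_trans (ler_norm_sum _ _ _) _.
rewrite big_nat; apply: (@le_trans _ _ (\sum_(0 <= n < N.+1) c)); last first.
  by rewrite sumr_const_nat subn0 mulr_natl.
rewrite [leRHS]big_nat; apply: ler_sum => n nN.
apply: le_trans (ler_norm_sum _ _ _) _.
under eq_bigr do rewrite normrM mulrC.
under eq_bigr do rewrite (ger0_norm ((dv n nN).1 _)).
by apply: sum_weight_le => [|s]; [exact: dv|exact: uc].
Qed.

End Dotp.

Section Bonus.
Context (R : realType) (X A : finType) (N T : nat) (l delta : R).
Variable w : nat -> nat -> X * A.

Lemma Cdelta_ge0 : 0 <= Cdelta X A N T delta.
Proof. exact: sqrtr_ge0. Qed.

Lemma bonus_ge0 t n z : 0 <= bonus N T delta w t n z.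
Proof. by rewrite /bonus; case: ifP => // _; rewrite divr_ge0 // sqrtr_ge0. Qed.

Lemma bonus_le t n z : bonus N T delta w t n z <= Cdelta X A N T delta.
Proof.
rewrite /bonus; case: ifP => [_|_]; last exact: Cdelta_ge0.
rewrite ler_pdivrMr; last by rewrite sqrtr_gt0 ltr0n leq_max.
rewrite ler_peMr ?Cdelta_ge0 //.
by rewrite -[leLHS]sqrtr1 ler_wsqrtr // ler1n leq_max.
Qed.

Lemma bonus_barE t n z : (n <= N)%N -> bonus_bar N T l delta w t n z =
  l * (N - n)%:R * bonus N T delta w t n z.
Proof.
move=> nN; rewrite /bonus_bar /bonus; case: ifP => _; rewrite ?mulr0 //.
by rewrite !mulrA.
Qed.

Lemma bonus_bar_ge0 t n z : 0 <= l -> (n <= N)%N ->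
  0 <= bonus_bar N T l delta w t n z.
Proof. by move=> l0 nN; rewrite bonus_barE // !mulr_ge0 // bonus_ge0. Qed.

Lemma bonus_bar_le t n z : 0 <= l -> (n <= N)%N ->
  bonus_bar N T l delta w t n z <= l * N%:R * bonus N T delta w t n z.
Proof.
move=> l0 nN; rewrite bonus_barE // ler_wpM2r ?bonus_ge0 // ler_wpM2l //.
by rewrite ler_nat leq_subr.
Qed.

End Bonus.

(** * A single run on which the estimated kernels are accurate *)

Section Run.
Context (R : realType) (X A : finType) (N T : nat) (dv : divergence).
Variables (eta alpha l gamma delta Psi : R).
Variables (p : nat -> X * A -> X -> R) (rho : X * A -> R).
Variables (w : nat -> nat -> X * A) (f : nat -> nat -> (X * A -> R) -> R).
Variables (pi : nat -> nat -> X -> A -> R) (mu g : nat -> nat -> X * A -> R).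
Variable pis : nat -> X -> A -> R.
Hypothesis T_gt0 : (0 < T)%N.
Hypothesis alpha01 : 0 <= alpha < 1.
Hypothesis l_ge0 : 0 <= l.
Hypothesis eta_gt0 : 0 < eta.
Hypothesis kp : is_kernel N p.
Hypothesis drho : is_dist rho.
Hypothesis kpis : is_policy N pis.
Hypothesis pis_periodic : push N p pis rho = rho.
Hypothesis contraction : forall nu nu' : X * A -> R, is_dist nu -> is_dist nu' ->
  l1dist (push N p pis nu) (push N p pis nu') <= alpha * l1dist nu nu'.
Hypothesis run : mdpp_k N T dv eta alpha l delta p rho w f pi mu g.

Local Notation q t := (@phat R X A w t).
Local Notation rt t := (rho_seq N p rho pi t).
Local Notation C := (Cdelta X A N T delta).
Local Notation b t := (bonus N T delta w t).
Local Notation tr t := (occ p (pi t) (rt t)).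
Local Notation cmp t := (occ (q t) pis (rt t)).

Lemma run_policy t : (1 <= t <= T)%N -> is_policy N (pi t).
Proof.
case: t => // -[_|t tT]; first exact: (run_start run).1.
by have [_ []] := run_induced run (tT : (1 <= t.+1 < T)%N).
Qed.

Lemma rho_seqS t : (0 < t)%N -> rt t.+1 = push N p (pi t) (rt t).
Proof. by case: t. Qed.

Lemma rho_seq_dist t : (1 <= t <= T.+1)%N -> is_dist (rt t).
Proof.
case: t => // t; elim: t => [_|t IHt tT]; first exact: drho.
rewrite rho_seqS //; apply: (@occ_dist _ _ _ N) => //; first exact: run_policy.
by apply: IHt; exact: ltnW.
Qed.

Lemma mu_occ t n : (1 <= t <= T)%N -> (n <= N)%N ->
  mu t n = occ (q t) (pi t) (rt t) n.
Proof.
case: t => // -[_ nN|t tT nN]; first exact: (run_start run).2.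
have [os ind] := run_induced run (tT : (1 <= t.+1 < T)%N).
exact: induced_occ os ind nN.
Qed.

Lemma mu_dist t n : (1 <= t <= T)%N -> (n <= N)%N -> is_dist (mu t n).
Proof.
move=> tT nN; rewrite mu_occ //; apply: (@occ_dist _ _ _ N) => //.
- exact: phat_kernel.
- exact: run_policy.
by case/andP: tT => t1 tT; apply: rho_seq_dist; rewrite t1 leqW.
Qed.

Lemma tr_dist t n : (1 <= t <= T)%N -> (n <= N)%N -> is_dist (tr t n).
Proof.
move=> tT nN; apply: (@occ_dist _ _ _ N) => //; first exact: run_policy.
by case/andP: tT => t1 tT; apply: rho_seq_dist; rewrite t1 leqW.
Qed.

Lemma cmp_dist t n : (1 <= t <= T)%N -> (n <= N)%N -> is_dist (cmp t n).
Proof.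
move=> tT nN; apply: (@occ_dist _ _ _ N) => //; first exact: phat_kernel.
by case/andP: tT => t1 tT; apply: rho_seq_dist; rewrite t1 leqW.
Qed.

Hypothesis obj_ok : forall t, (1 <= t <= T)%N -> objective_ok N l (f t).
Hypothesis accurate : forall t n z, (1 <= t <= T)%N -> (n < N)%N ->
  l1dist (q t n.+1 z) (p n.+1 z) <= b t n z.
Hypothesis pos : forall t, (1 <= t <= T)%N -> positive N dv (mu t) (pi t).
Hypothesis logref_le : forall t n z, (1 <= t <= T)%N -> (n <= N)%N ->
  `|logref dv (mu t) (pi t) n z| <= Psi.

(** The bonus averaged over the true flow, whose sum over episodes can be estimated because this
    flow generates the observed trajectories. *)
Local Notation beta t := (dotp N (tr t) (b t)).
Local Notation r t := (l1dist (rt t) rho).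

Lemma partial_dotp_le t n (m : nat -> X * A -> R) (d : nat -> X * A -> R) :
  (n <= N)%N -> (forall n z, (n <= N)%N -> 0 <= m n z) ->
  (forall n z, (n < N)%N -> d n z <= b t n z) ->
  \sum_(0 <= k < n) \sum_z m k z * d k z <= dotp N m (b t).
Proof.
move=> nN m0 db.
rewrite /dotp (@big_cat_nat _ _ _ n 0 N.+1) ?leqW //=.
rewrite -[leLHS]addr0 lerD //.
  rewrite !big_nat; apply: ler_sum => k kn; apply: ler_sum => z _.
  have kN : (k < N)%N by exact: leq_trans kn nN.
  by rewrite ler_wpM2l ?db // m0 // ltnW.
rewrite big_nat; apply: sumr_ge0 => k /andP[_ kN]; apply: sumr_ge0 => z _.
by rewrite mulr_ge0 ?bonus_ge0 ?m0.
Qed.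

Lemma mu_tr_le t n : (1 <= t <= T)%N -> (n <= N)%N ->
  l1dist (mu t n) (tr t n) <= beta t.
Proof.
move=> tT nN; rewrite mu_occ //.
have drt : is_dist (rt t) by exact: (tr_dist tT (leq0n N)).
have := occ_perturb (rt t) (phat_kernel R w (N:=N) t) kp (run_policy tT) drt nN.
move=> /le_trans; apply; rewrite l1distxx add0r.
apply: (partial_dotp_le (d := fun k z => l1dist (q t k.+1 z) (p k.+1 z))) => //.
  by move=> k z kN; exact: (tr_dist tT kN).1.
by move=> k z; exact: accurate.
Qed.

Lemma beta_ge0 t : (1 <= t <= T)%N -> 0 <= beta t.
Proof.
move=> tT; apply: dotp_ge0 => n z nN; last exact: bonus_ge0.
exact: (tr_dist tT nN).1.
Qed.

(** Moving the bonus from [mu t] to the true flow costs at most [C] per unit of distance at each of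
    the [N + 1] times. *)
Lemma dotp_mu_bonus_le t : (1 <= t <= T)%N ->
  dotp N (mu t) (b t) <= (1 + N.+1%:R * C) * beta t.
Proof.
move=> tT; rewrite mulrDl mul1r.
have -> : N.+1%:R * C * beta t = \sum_(0 <= n < N.+1) (C * beta t).
  by rewrite sumr_const_nat subn0 -[RHS]mulr_natl mulrA.
rewrite {1 2}/dotp -big_split !big_nat; apply: ler_sum => n nN.
apply: le_trans (@ler_weight_l1dist _ _ _ (tr t n) _ C _) _.
  by move=> z; rewrite bonus_ge0 bonus_le.
by rewrite lerD2l ler_wpM2l ?Cdelta_ge0 // mu_tr_le.
Qed.

(** The bonuses stay under the comparator's own flow, where sampling gives no control; [bonus_bar]
    cancels them later. *)
Lemma cmp_le t n : (1 <= t <= T)%N -> (n <= N)%N ->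
  l1dist (cmp t n) (occ p pis rho n) <=
  r t + \sum_(0 <= m < n) \sum_z cmp t m z * b t m z.
Proof.
move=> tT nN; rewrite l1distC.
have drt : is_dist (rt t) by exact: (tr_dist tT (leq0n N)).
apply: le_trans (occ_perturb _ kp (phat_kernel R w (N:=N) t) kpis drt nN) _.
rewrite l1distC lerD2l !big_nat; apply: ler_sum => m mn; apply: ler_sum => z _.
have mN : (m < N)%N by exact: leq_trans mn nN.
by rewrite ler_wpM2l ?(cmp_dist tT (ltnW mN)).1 // l1distC accurate.
Qed.

(* The contraction is used from [rho_t] and the bonus pays for the kernel error. *)
Lemma cmp_feasible t : (1 <= t <= T)%N ->
  feasible N T alpha delta p rho w pi t (cmp t).
Proof.
move=> tT; have drt : is_dist (rt t) by exact: (tr_dist tT (leq0n N)).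
split; first exact: occ_set_occ (phat_kernel R w (N:=N) t) kpis drt.
rewrite -!/(l1dist _ _).
apply: le_trans (l1dist_triangle (push N p pis (rt t)) _ _) _.
apply: lerD; last by rewrite -[X in l1dist _ X <= _]pis_periodic contraction.
rewrite /push l1distC.
apply: le_trans (occ_perturb _ kp (phat_kernel R w (N:=N) t) kpis drt (leqnn N)) _.
rewrite l1distxx add0r.
apply: (partial_dotp_le (d := fun k z => l1dist (p k.+1 z) (q t k.+1 z))) => //.
  by move=> k z kN; exact: (cmp_dist tT kN).1.
by move=> k z kN; rewrite l1distC accurate.
Qed.

(** The next initial law is the true final law of episode [t]. It is within [beta t] of the
    predicted law [mu t N], which the constraint keeps near [rho]. The last term allows for the
    first episode, where no constraint is imposed. *)
Lemma rho_drift t : (1 <= t <= T)%N ->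
  r t.+1 <= alpha * r t + (2 + N.+1%:R * C) * beta t + 2 * (t == 1%N)%:R.
Proof.
move=> tT; have bt := beta_ge0 tT; have C0 := Cdelta_ge0 X A N T delta.
have /andP[t1 tT'] := tT; have /andP[a0 a1] := alpha01.
have NC0 : 0 <= N.+1%:R * C by rewrite mulr_ge0.
have [t_eq1|t_neq1] := eqVneq t 1%N.
  have : r t.+1 <= 2 by apply: l1dist_le2 => //; apply: rho_seq_dist.
  have := mulr_ge0 a0 (l1dist_ge0 (rt t) rho).
  by have := mulr_ge0 NC0 bt => /=; lra.
have t2 : (1 <= t.-1 < T)%N.
  by rewrite prednK // tT' andbT -ltnS prednK // ltn_neqAle eq_sym t_neq1.
have tS : (1 <= t.-1.+1 <= T)%N by rewrite prednK.
have [F _] := run_argmin run t2 (ex_intro _ _ (cmp_feasible tS)).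
rewrite prednK // in F; have {F} [_] := F; rewrite -!/(l1dist _ _) => F.
have E := mu_tr_le tT (leqnn N); rewrite l1distC in E.
have := l1dist_triangle (mu t N) (tr t N) rho; rewrite rho_seqS // /push.
by have := dotp_mu_bonus_le tT; rewrite mulr0 addr0; lra.
Qed.

(** Since [r 1 = 0], summing the recursion gives [S <= alpha S + ...], which is solved for [S]. *)
Lemma sum_rho_le (B : R) : \sum_(1 <= t < T.+1) beta t <= B ->
  \sum_(1 <= t < T.+1) r t <= (2 + (2 + N.+1%:R * C) * B) / (1 - alpha).
Proof.
move=> HB; have /andP[a0 a1] := alpha01; have C0 := Cdelta_ge0 X A N T delta.
rewrite ler_pdivlMr ?subr_gt0 //.
have NC0 : 0 <= N.+1%:R * C by rewrite mulr_ge0.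
set S := \sum_(1 <= t < T.+1) _.
have SE : S = \sum_(1 <= t < T) r t.+1.
  by rewrite /S big_nat_recl //= l1distxx add0r.
have S1 : \sum_(1 <= t < T) r t <= S.
  by rewrite /S [leRHS]big_nat_recr //= lerDl l1dist_ge0.
have B1 : \sum_(1 <= t < T) beta t <= B.
  apply: le_trans HB; rewrite [leRHS]big_nat_recr //= lerDl beta_ge0 //.
  by rewrite T_gt0 leqnn.
have one : \sum_(1 <= t < T) (t == 1%N)%:R <= 1 :> R.
  case: (T) T_gt0 => [//|[_|k _]]; first by rewrite big_geq.
  rewrite big_ltn //= big_nat big1 ?addr0 // => i /andP[i2 _].
  by rewrite gtn_eqF.
have : S <= alpha * (\sum_(1 <= t < T) r t) +
    (2 + N.+1%:R * C) * (\sum_(1 <= t < T) beta t) +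
    2 * (\sum_(1 <= t < T) (t == 1%N)%:R).
  rewrite SE !mulr_sumr -!big_split !big_nat; apply: ler_sum => t /andP[t1 tT].
  by apply: rho_drift; rewrite t1 ltnW.
have := ler_wpM2l a0 S1; have := ler_wpM2l (addr_ge0 (ler0n R 2) NC0) B1.
lra.
Qed.

(** Bounds how far the flow of any fixed policy under the estimated kernels moves from episode [t]
    to the next. Kernel changes enter unweighted, so that the same quantity serves every flow. *)
Definition drift t : R := l1dist (rt t.+1) (rt t) +
  \sum_(0 <= n < N) \sum_z l1dist (q t.+1 n.+1 z) (q t n.+1 z).

Lemma drift_ge0 t : 0 <= drift t.
Proof.
rewrite addr_ge0 ?l1dist_ge0 // !sumr_ge0 // => n _.
by rewrite sumr_ge0 // => z _; exact: l1dist_ge0.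
Qed.

Lemma partial_drift_le t n (m : nat -> X * A -> R) : (n <= N)%N ->
  (forall k, (k <= N)%N -> is_dist (m k)) ->
  l1dist (rt t.+1) (rt t) +
  \sum_(0 <= k < n) \sum_z m k z * l1dist (q t.+1 k.+1 z) (q t k.+1 z) <= drift t.
Proof.
move=> nN dm; rewrite lerD2l [leRHS](@big_cat_nat _ _ _ n) //=.
rewrite -[leLHS]addr0 lerD //; last first.
  by rewrite !sumr_ge0 // => k _; rewrite sumr_ge0 // => z _; exact: l1dist_ge0.
rewrite !big_nat; apply: ler_sum => k kn; apply: ler_sum => z _.
by rewrite ler_piMl ?l1dist_ge0 // dist_le1 //; apply: dm; rewrite ltnW // (leq_trans kn).
Qed.

Lemma cmp_drift t n : (1 <= t < T)%N -> (n <= N)%N ->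
  l1dist (cmp t.+1 n) (cmp t n) <= drift t.
Proof.
move=> /andP[t1 tT] nN; have tT' : (1 <= t <= T)%N by rewrite t1 ltnW.
apply: le_trans (partial_drift_le t nN (fun k => cmp_dist tT' (n := k))).
apply: (@occ_perturb _ _ _ N) => //; try exact: phat_kernel.
exact: (cmp_dist tT' (leq0n N)).
Qed.

(** The iterate moves for two reasons: initial law and kernel change, which [drift t] accounts for,
    and the policy changes, which the distances to [base] measure. *)
Lemma mu_drift t n : (1 <= t < T)%N -> (n <= N)%N ->
  l1dist (mu t n) (mu t.+1 n) <= drift t +
  \sum_(0 <= m < N.+1) l1dist (mu t.+1 m) (base dv (mu t) (pi t) (mu t.+1) m).
Proof.
move=> /andP[t1 tT] nN; have tT' : (1 <= t <= T)%N by rewrite t1 ltnW.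
have tS : (1 <= t.+1 <= T)%N by [].
pose E m := l1dist (mu t.+1 m) (base dv (mu t) (pi t) (mu t.+1) m).
have E0 m : 0 <= E m by exact: l1dist_ge0.
rewrite -/(E _); rewrite (eq_bigr E) //.
have part k : (k <= N)%N -> \sum_(0 <= m < k.+1) E m <= \sum_(0 <= m < N.+1) E m.
  move=> kN; rewrite [leRHS](@big_cat_nat _ _ _ k.+1) //= lerDl sumr_ge0 //.
(* For [KL], [base] is [mu t] itself. For [Gamma] the policy errors accumulate over time and are
   collected by induction. *)
case dvE : dv.
  apply: le_trans (_ : _ <= E n) _; first by rewrite /E /base dvE l1distC.
  rewrite -[leLHS]add0r lerD ?drift_ge0 //; apply: le_trans (part n nN).
  by rewrite big_nat_recr //= lerDr sumr_ge0.
suff : l1dist (mu t n) (mu t.+1 n) <= l1dist (rt t.+1) (rt t) +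
    \sum_(0 <= k < n) \sum_z mu t.+1 k z * l1dist (q t.+1 k.+1 z) (q t k.+1 z) +
    \sum_(0 <= m < n.+1) E m.
  move=> /le_trans; apply; apply: lerD; last exact: part.
  by apply: partial_drift_le => // k kN; exact: mu_dist.
elim: n nN => [|n IHn] nN.
  rewrite big_geq // addr0 !mu_occ //= l1distC lerDl big_nat1; exact: E0.
have IH := IHn (ltnW nN).
have muS s : (1 <= s <= T)%N ->
    mu s n.+1 = next (q s n.+1) (pi s n.+1) (mu s n).
  by move=> sT; rewrite !mu_occ // ltnW.
have := @next_perturb R X A (q t n.+1) (q t.+1 n.+1) (pi t n.+1) (pi t.+1 n.+1)
  (mu t n) (mu t.+1 n).
have dp x : is_dist (pi t n.+1 x) by exact: run_policy.
have dp' x : is_dist (pi t.+1 n.+1 x) by exact: run_policy.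
move=> /(_ (phat_dist R w t n) dp dp' (mu_dist tS (ltnW nN)).1).
rewrite -!muS // => H; apply: le_trans H _.
rewrite [X in _ <= _ + X]big_nat_recr // [X in _ <= _ + X + _]big_nat_recr //=.
have -> : E n.+1 = \sum_z `|mu t.+1 n.+1 z -
    (\sum_a mu t.+1 n.+1 (z.1, a)) * pi t n.+1 z.1 z.2|.
  by rewrite /E /base dvE.
under [X in _ + X + _ <= _]eq_bigr do rewrite l1distC.
lra.
Qed.

Lemma sum_drift_le (Sr : R) : \sum_(1 <= t < T.+1) r t <= Sr ->
  \sum_(1 <= t < T) drift t <=
  2 * Sr + 6 * N%:R * #|{: X * A}|%:R * Num.sqrt T%:R.
Proof.
move=> HS; rewrite big_split /=; apply: lerD.
  apply: (@le_trans _ _ (\sum_(1 <= t < T) (r t.+1 + r t))).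
    by apply: ler_sum => t _; rewrite [X in _ <= _ + X]l1distC l1dist_triangle.
  rewrite big_split /=.
  have : \sum_(1 <= t < T) r t.+1 <= Sr.
    by apply: le_trans HS; rewrite [leRHS]big_nat_recl //= lerDr l1dist_ge0.
  have : \sum_(1 <= t < T) r t <= Sr.
    by apply: le_trans HS; rewrite [leRHS]big_nat_recr //= lerDl l1dist_ge0.
  lra.
have := @sum_visit_sqrt_le R X A w N T T; rewrite T_gt0 leqnSn => /(_ isT) H.
have -> : 6 * N%:R * #|{: X * A}|%:R * Num.sqrt T%:R =
    2 * (3 * N%:R * #|{: X * A}|%:R * Num.sqrt T%:R) :> R by ring.
apply: le_trans (ler_wpM2l (ler0n R 2) H).
rewrite exchange_big /= mulr_sumr; apply: ler_sum => n _.
rewrite exchange_big /= mulr_sumr; apply: ler_sum => z _.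
rewrite mulr_sumr !big_nat; apply: ler_sum => t /andP[t1 _].
exact: phat_drift.
Qed.

Local Notation G t := (fun n z => g t n z - bonus_bar N T l delta w t n z).
Local Notation Gmax := (l + l * N%:R * C).
Local Notation L t := (logref dv (mu t) (pi t)).

Lemma subgradient_run t : (1 <= t <= T)%N ->
  is_subgradient N (total_obj N (f t)) (mu t) (g t).
Proof.
by move=> tT; apply: nabla_subgradient (obj_ok tT) (run_nabla run tT).
Qed.

Lemma Gmax_ge0 : 0 <= Gmax.
Proof. by rewrite addr_ge0 // !mulr_ge0 // Cdelta_ge0. Qed.

Lemma G_le t n z : (1 <= t <= T)%N -> (n <= N)%N -> `|G t n z| <= Gmax.
Proof.
move=> tT nN; apply: le_trans (ler_normB _ _) _; apply: lerD.
  exact: subgradient_bound l_ge0 (obj_ok tT) (subgradient_run tT) nN.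
rewrite ger0_norm ?bonus_bar_ge0 //; apply: le_trans (bonus_bar_le _ _ _ _ _ l_ge0 nN) _.
by rewrite ler_wpM2l ?bonus_le // mulr_ge0.
Qed.

(** The constraint bounds a convex function of the flow by an affine one. Optimality can thus be
    tested along the segment to the comparator. *)
Lemma feasible_mix t mu1 mu2 (h : R) : 0 <= h <= 1 ->
  feasible N T alpha delta p rho w pi t mu1 ->
  feasible N T alpha delta p rho w pi t mu2 ->
  feasible N T alpha delta p rho w pi t (mix h mu1 mu2).
Proof.
move=> h01 [[d1' s1 fl1] c1] [[d2' s2 fl2] c2]; have /andP[h0 h1] := h01.
split; first split.
- by move=> n nN; apply: is_dist_conv => //; [exact: d1'|exact: d2'].
- by apply/funext => z; rewrite /mix s1 s2; ring.
- move=> n x nN; rewrite /mix big_split /= -!mulr_sumr fl1 // fl2 //.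
  rewrite !mulr_sumr -big_split /=; apply: eq_bigr => z _; ring.
have -> : dotp N (mix h mu1 mu2) (b t) =
    (1 - h) * dotp N mu1 (b t) + h * dotp N mu2 (b t).
  rewrite /dotp !mulr_sumr -big_split; apply: eq_bigr => n _ /=.
  by rewrite !mulr_sumr -big_split; apply: eq_bigr => z _ /=; rewrite /mix; ring.
apply: (@le_trans _ _ ((1 - h) * norm1 (fun z => mu1 N z - rho z) +
    h * norm1 (fun z => mu2 N z - rho z))).
  rewrite /norm1 !mulr_sumr -big_split; apply: ler_sum => z _ /=.
  have -> : mix h mu1 mu2 N z - rho z =
    (1 - h) * (mu1 N z - rho z) + h * (mu2 N z - rho z) by rewrite /mix; ring.
  apply: le_trans (ler_normD _ _) _.
  by rewrite !normrM (ger0_norm h0) (@ger0_norm _ (1 - h)) // subr_ge0.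
have k0 : 0 <= 1 - h by rewrite subr_ge0.
have := ler_wpM2l k0 c1; have := ler_wpM2l h0 c2; lra.
Qed.

(** Write [mu_t - cmp_t] as [(mu_t - mu_{t+1}) + (mu_{t+1} - cmp_{t+1}) + (cmp_{t+1} - cmp_t)].
    Optimality of [mu_{t+1}] handles the middle difference; each outer one costs a drift, whence the
    factor 2, and the policy part of the first is paid by the divergence. *)
Lemma mirror_step t : (1 <= t < T)%N ->
  eta * dotp N (G t) (fun n z => mu t n z - cmp t n z) <=
  2 * eta * Gmax * N.+1%:R * drift t + N.+1%:R * (eta * Gmax * N.+1%:R) ^+ 2 +
  dotp N (cmp t.+1) (fun n z => L t.+1 n z - L t n z).
Proof.
move=> tT'; have /andP[t1 tT] := tT'; have tT0 : (1 <= t <= T)%N by rewrite t1 ltnW.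
have tS : (1 <= t.+1 <= T)%N by [].
have [oset ind] := run_induced run tT'.
have fcmp := cmp_feasible tS.
have [fmu opt] := run_argmin run tT' (ex_intro _ _ fcmp).
have dmu' n : (n <= N)%N -> is_dist (mu t.+1 n) by exact: mu_dist.
have dcmp' n : (n <= N)%N -> is_dist (cmp t.+1 n) by exact: cmp_dist.
have FO : 0 <= dotp N (fun n z => eta * G t n z + L t.+1 n z - L t n z)
         (fun n z => cmp t.+1 n z - mu t.+1 n z).
  apply: (first_order_optimality (pos tS) (pos tT0) ind) => //.
    move=> n z nN; apply: (occ_set_dominated (pos tS) ind oset fcmp.1 _ nN).
    by move=> k z' x kN; exact: (phat_kernel R w t.+1 z' kN).1.
  move=> h /andP[h0 h1].
  have h01 : 0 <= h <= 1 by rewrite ltW.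
  have fm := feasible_mix h01 fmu fcmp.
  have := opt _ fm; rewrite /step_obj !DpsiE ?lee_fin //; try exact: pos.
    by move=> n z nN; have [dm _ _] := fm.1; exact: (dm n nN).1.
  by move=> n z nN; exact: (dmu' n nN).1.
(* The parameter equals the coefficient of [SE] in the stability term, so the two cancel. The
   divergence, rewritten through the potentials, cancels the part of [FO] evaluated at [mu t.+1]. *)
have PI := @rDpsi_pinsker R X A N dv (eta * Gmax * N.+1%:R) (mu t.+1) (mu t) (pi t)
  (pos tT0) (run_policy tT0) (fun n => mu_dist tT0 (n := n)) dmu'.
rewrite (rDpsi_diff (pos tT0) (pos tS) (fun n z nN => (dmu' n nN).1 z)) in PI.
rewrite rDpsi_self // add0r in PI.
have e0 := ltW eta_gt0; have G0 := Gmax_ge0.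
set SE := \sum_(0 <= n < N.+1) _ in PI.
have A1 : dotp N (G t) (fun n z => mu t n z - mu t.+1 n z) <=
    Gmax * (N.+1%:R * (drift t + SE)).
  apply: le_trans (dotp_le_l1dist _ _ (fun n z => @G_le t n z tT0)) _.
  rewrite ler_wpM2l //; have -> : N.+1%:R * (drift t + SE) =
      \sum_(0 <= n < N.+1) (drift t + SE).
    by rewrite sumr_const_nat subn0 mulr_natl.
  by rewrite !big_nat; apply: ler_sum => n nN; exact: mu_drift.
have A2 : dotp N (G t) (fun n z => cmp t.+1 n z - cmp t n z) <=
    Gmax * (N.+1%:R * drift t).
  apply: le_trans (dotp_le_l1dist _ _ (fun n z => @G_le t n z tT0)) _.
  rewrite ler_wpM2l //; have -> : N.+1%:R * drift t =
      \sum_(0 <= n < N.+1) drift t.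
    by rewrite sumr_const_nat subn0 mulr_natl.
  by rewrite !big_nat; apply: ler_sum => n nN; exact: cmp_drift.
have := ler_wpM2l e0 A1; have := ler_wpM2l e0 A2; move: FO PI.
have -> : dotp N (fun n z => eta * G t n z + L t.+1 n z - L t n z)
         (fun n z => cmp t.+1 n z - mu t.+1 n z) =
   eta * dotp N (G t) (fun n z => cmp t.+1 n z - mu t.+1 n z) +
   dotp N (cmp t.+1) (fun n z => L t.+1 n z - L t n z) -
   dotp N (mu t.+1) (fun n z => L t.+1 n z - L t n z).
  rewrite /dotp mulr_sumr -big_split -sumrB; apply: eq_bigr => n _ /=.
  by rewrite mulr_sumr -big_split -sumrB; apply: eq_bigr => z _ /=; ring.
rewrite !(dotpBr N (G t)); lra.
Qed.

(* Summation by parts: the comparator moves slowly, so only its drift is charged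
   to the potentials. *)
Lemma potential_sum (SV : R) : \sum_(1 <= t < T) drift t <= SV ->
  \sum_(1 <= t < T) dotp N (cmp t.+1) (fun n z => L t.+1 n z - L t n z) <=
  N.+1%:R * Psi * (2 + SV).
Proof.
move=> HV; have T1 : (1 <= 1 <= T)%N by rewrite T_gt0.
have TT : (1 <= T <= T)%N by rewrite T_gt0 leqnn.
have tele : \sum_(1 <= t < T) (dotp N (cmp t.+1) (L t.+1) - dotp N (cmp t) (L t)) =
    dotp N (cmp T) (L T) - dotp N (cmp 1) (L 1).
  by rewrite (telescope_sumr (fun t => dotp N (cmp t) (L t))).
have P0 : 0 <= Psi.
  have /card_gt0P[z _] := dist_card drho.
  exact: le_trans (normr_ge0 _) (logref_le z T1 (leq0n N)).
have := dotp_le_dist (fun n z => logref_le z TT) (fun n => cmp_dist TT (n := n)).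
have := dotp_le_dist (fun n z => logref_le z T1) (fun n => cmp_dist T1 (n := n)).
rewrite !ler_norml => /andP[A1 _] /andP[_ A2].
rewrite dotpC in A1; rewrite dotpC in A2.
have : \sum_(1 <= t < T) dotp N (cmp t.+1) (fun n z => L t.+1 n z - L t n z) <=
   \sum_(1 <= t < T) (dotp N (cmp t.+1) (L t.+1) - dotp N (cmp t) (L t)) +
   N.+1%:R * Psi * \sum_(1 <= t < T) drift t.
  rewrite mulr_sumr -big_split !big_nat; apply: ler_sum => t tT' /=.
  have /andP[t1 tT] := tT'; have tT0 : (1 <= t <= T)%N by rewrite t1 ltnW.
  have := dotp_le_l1dist (cmp t) (cmp t.+1) (fun n z => @logref_le t n z tT0).
  have : \sum_(0 <= n < N.+1) l1dist (cmp t n) (cmp t.+1 n) <= N.+1%:R * drift t.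
    have -> : N.+1%:R * drift t = \sum_(0 <= n < N.+1) drift t.
      by rewrite sumr_const_nat subn0 mulr_natl.
    by rewrite !big_nat; apply: ler_sum => n nN; rewrite l1distC; exact: cmp_drift.
  move=> /(ler_wpM2l P0); rewrite !dotpBr (dotpC N (L t) (cmp t)) (dotpC N (L t) (cmp t.+1)).
  by lra.
rewrite tele; have := ler_wpM2l (mulr_ge0 (ler0n R N.+1) P0) HV; lra.
Qed.

(** The last episode has no update after it and is bounded by [2 Gmax (N + 1)]; the others are
    summed and divided by [eta]. *)
Lemma mirror_regret (SV : R) : \sum_(1 <= t < T) drift t <= SV ->
  \sum_(1 <= t < T.+1) dotp N (G t) (fun n z => mu t n z - cmp t n z) <=
  2 * Gmax * N.+1%:R * (SV + 1) + T%:R * N.+1%:R ^+ 3 * Gmax ^+ 2 * eta +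
  N.+1%:R * Psi * (2 + SV) / eta.
Proof.
move=> HV; have TT : (1 <= T <= T)%N by rewrite T_gt0 leqnn.
have G0 := Gmax_ge0; have e0 := ltW eta_gt0.
rewrite big_nat_recr //=.
have last : dotp N (G T) (fun n z => mu T n z - cmp T n z) <= 2 * Gmax * N.+1%:R.
  have := dotp_le_dist (fun n z => @G_le T n z TT) (fun n => mu_dist TT (n := n)).
  have := dotp_le_dist (fun n z => @G_le T n z TT) (fun n => cmp_dist TT (n := n)).
  rewrite !ler_norml dotpBr => /andP[A1 _] /andP[_ A2]; lra.
have main : eta * (\sum_(1 <= t < T) dotp N (G t) (fun n z => mu t n z - cmp t n z))
  <= 2 * eta * Gmax * N.+1%:R * SV + T%:R * (N.+1%:R * (eta * Gmax * N.+1%:R) ^+ 2) +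
     N.+1%:R * Psi * (2 + SV).
  apply: le_trans (lerD (lerD (ler_wpM2l _ HV) _) (potential_sum HV)).
  - rewrite mulr_sumr.
    have : \sum_(1 <= t < T) eta * dotp N (G t) (fun n z => mu t n z - cmp t n z)
      <= \sum_(1 <= t < T) (2 * eta * Gmax * N.+1%:R * drift t +
         N.+1%:R * (eta * Gmax * N.+1%:R) ^+ 2 +
         dotp N (cmp t.+1) (fun n z => L t.+1 n z - L t n z)).
      by rewrite !big_nat; apply: ler_sum => t tT; exact: mirror_step.
    move=> /le_trans; apply; rewrite big_split /= big_split /=.
    rewrite -[X in X + _ + _ <= _]mulr_sumr; exact: lexx.
  - by rewrite !mulr_ge0.
  rewrite sumr_const_nat -[leLHS]mulr_natl ler_wpM2r //.
    by rewrite mulr_ge0 // sqr_ge0.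
  by rewrite ler_nat leq_subr.
have : \sum_(1 <= t < T) dotp N (G t) (fun n z => mu t n z - cmp t n z) <=
  2 * Gmax * N.+1%:R * SV + T%:R * N.+1%:R ^+ 3 * Gmax ^+ 2 * eta +
  N.+1%:R * Psi * (2 + SV) / eta.
  rewrite -(ler_pM2l eta_gt0); apply: le_trans main _.
  rewrite le_eqVlt; apply/orP; left; apply/eqP; field; exact: lt0r_neq0.
lra.
Qed.

Lemma sum_constN (c : R) : \sum_(1 <= n < N.+1) c = N%:R * c.
Proof. by rewrite sumr_const_nat subSS subn0 mulr_natl. Qed.

(* The bonus [bonus_bar] in the loss pays exactly for evaluating the comparator
   under the estimated kernel. *)
Lemma episode_regret t : (1 <= t <= T)%N ->
  total_obj N (f t) (tr t) - total_obj N (f t) (occ p pis rho) <=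
  l * N%:R * (2 + N.+1%:R * C) * beta t +
  dotp N (G t) (fun n z => mu t n z - cmp t n z) + l * N%:R * r t.
Proof.
move=> tT.
(* The comparison goes from the true flow to [mu t] ([E1]), by the subgradient inequality to the
   comparator ([E2]), and on to the flow of [pis] from [rho] ([E3]). The comparator's bonus in [E3]
   is cancelled through [E5]; the bonus on [mu t] that this leaves is bounded by [E4]. *)
have E1 : total_obj N (f t) (tr t) - total_obj N (f t) (mu t) <= l * (N%:R * beta t).
  apply: le_trans (total_obj_lip _ _ (obj_ok tT)) _; rewrite ler_wpM2l //.
  rewrite -sum_constN !big_nat; apply: ler_sum => n /andP[_ nN].
  by rewrite l1distC mu_tr_le.
have E2 := subgradient_run tT (cmp t).
have E3 : total_obj N (f t) (cmp t) - total_obj N (f t) (occ p pis rho) <=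
    l * (N%:R * r t) + dotp N (cmp t) (bonus_bar N T l delta w t).
  apply: le_trans (total_obj_lip _ _ (obj_ok tT)) _.
  have -> : dotp N (cmp t) (bonus_bar N T l delta w t) =
      l * \sum_(1 <= n < N.+1) \sum_(0 <= m < n) \sum_z cmp t m z * b t m z.
    rewrite triangular_sum /dotp big_nat_recr //= [X in _ + X]big1 ?addr0; last first.
      by move=> z _; rewrite /bonus_bar ltnn mulr0.
    rewrite mulr_sumr !big_nat; apply: eq_bigr => n nN.
    rewrite !mulr_sumr; apply: eq_bigr => z _; rewrite bonus_barE 1?ltnW //; ring.
  rewrite -mulrDr ler_wpM2l // -sum_constN -big_split !big_nat.
  by apply: ler_sum => n /andP[_ nN]; exact: cmp_le.
have E4 : dotp N (mu t) (bonus_bar N T l delta w t) <=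
    l * N%:R * ((1 + N.+1%:R * C) * beta t).
  apply: (@le_trans _ _ (l * N%:R * dotp N (mu t) (b t))); last first.
    by rewrite ler_wpM2l ?mulr_ge0 // dotp_mu_bonus_le.
  rewrite /dotp mulr_sumr !big_nat; apply: ler_sum => n nN.
  rewrite mulr_sumr; apply: ler_sum => z _; rewrite mulrCA ler_wpM2l //.
    exact: (mu_dist tT nN).1.
  exact: bonus_bar_le.
have E5 : dotp N (G t) (fun n z => mu t n z - cmp t n z) =
  dotp N (mu t) (bonus_bar N T l delta w t) * -1 +
  dotp N (cmp t) (bonus_bar N T l delta w t) -
  dotp N (g t) (fun n z => cmp t n z - mu t n z).
  rewrite dotpBl !dotpBr !(dotpC N (bonus_bar _ _ _ _ _ _)); ring.
rewrite E5; lra.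
Qed.

Lemma regret_bound (B Sr SV : R) : 0 <= gamma ->
  \sum_(1 <= t < T.+1) beta t <= B ->
  Sr = (2 + (2 + N.+1%:R * C) * B) / (1 - alpha) ->
  SV = 2 * Sr + 6 * N%:R * #|{: X * A}|%:R * Num.sqrt T%:R ->
  regret N T gamma p rho f pi pis <=
  l * N%:R * (2 + N.+1%:R * C) * B + (l * N%:R + gamma) * Sr +
  2 * Gmax * N.+1%:R * (SV + 1) + T%:R * N.+1%:R ^+ 3 * Gmax ^+ 2 * eta +
  N.+1%:R * Psi * (2 + SV) / eta.
Proof.
move=> gamma0 HB SrE SVE; have HS := sum_rho_le HB.
have MR := mirror_regret (sum_drift_le HS).
have C0 := Cdelta_ge0 X A N T delta.
rewrite -SrE in HS MR; rewrite -SVE in MR.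
have : \sum_(1 <= t < T.+1)
    (total_obj N (f t) (tr t) - total_obj N (f t) (occ p pis rho)) <=
  l * N%:R * (2 + N.+1%:R * C) * (\sum_(1 <= t < T.+1) beta t) +
  (\sum_(1 <= t < T.+1) dotp N (G t) (fun n z => mu t n z - cmp t n z)) +
  l * N%:R * (\sum_(1 <= t < T.+1) r t).
  rewrite !mulr_sumr -!big_split !big_nat; apply: ler_sum => t tT.
  exact: episode_regret.
have c0 : 0 <= l * N%:R * (2 + N.+1%:R * C).
  by rewrite !mulr_ge0 // addr_ge0 // mulr_ge0.
have := ler_wpM2l c0 HB; have := ler_wpM2l (mulr_ge0 l_ge0 (ler0n R N)) HS.
have := ler_wpM2l gamma0 HS; rewrite /regret -/(l1dist _ _); lra.
Qed.

End Run.

(** * Exponential moments and trajectory laws *)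

Section Hoeffding.
Context (R : realType).

(** Squaring the bound at [y] gives one at [2 y]; the last hypothesis compares the coefficients of
    [y^2] in the expansion, using [y <= Y]. *)
Lemma expR_double (y Y c c' : R) : 0 <= y <= Y -> 0 <= c ->
  expR y <= 1 + y + c * y ^+ 2 ->
  1 + 2 * c + 2 * c * Y + c ^+ 2 * Y ^+ 2 <= 4 * c' ->
  expR (2 * y) <= 1 + 2 * y + c' * (2 * y) ^+ 2.
Proof.
move=> /andP[y0 yY] c0 Hy Hc.
have -> : 2 * y = y + y by ring.
rewrite expRD.
apply: (@le_trans _ _ ((1 + y + c * y ^+ 2) * (1 + y + c * y ^+ 2))).
  by rewrite ler_pM ?expR_ge0.
have A1 : 2 * c * y <= 2 * c * Y by rewrite ler_wpM2l // mulr_ge0.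
have A2 : c ^+ 2 * y ^+ 2 <= c ^+ 2 * Y ^+ 2.
  by rewrite ler_wpM2l ?sqr_ge0 // lerXn2r // nnegrE // (le_trans y0).
have y2 := sqr_ge0 y.
have : y ^+ 2 * (1 + 2 * c + 2 * c * y + c ^+ 2 * y ^+ 2) <= y ^+ 2 * (4 * c').
  by rewrite ler_wpM2l //; lra.
lra.
Qed.

(** For [x < 0] this follows from [expR x <= 1/(1 - x)]. For [x >= 0] that bound is too weak, so it
    is used at [x/8] and squared three times; 23/20, 91/100 and 84/100 are rounded values for which
    the constant ends at 1. *)
Lemma expR_le_quad (x : R) : `|x| <= 1 -> expR x <= 1 + x + x ^+ 2.
Proof.
rewrite ler_norml => /andP[x1 x2]; have [x0|x0] := leP 0 x; last first.
  have := expR_ge1Dx (- x); rewrite expRN => H.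
  have p0 : 0 < 1 - x by lra.
  have : expR x <= (1 - x)^-1.
    by rewrite -[expR x]invrK lef_pV2 ?posrE ?invr_gt0 ?expR_gt0.
  move=> /le_trans; apply; rewrite -div1r ler_pdivrMr //.
  have x0' : 0 <= - x by lra.
  have := exprn_ge0 3 x0'.
  lra.
have H8 : expR (x / 8) <= 1 + x / 8 + 23 / 20 * (x / 8) ^+ 2.
  have := expR_ge1Dx (- (x / 8)); rewrite expRN => H.
  have p0 : 0 < 1 - x / 8 by lra.
  have : expR (x / 8) <= (1 - x / 8)^-1.
    by rewrite -[expR _]invrK lef_pV2 ?posrE ?invr_gt0 ?expR_gt0.
  move=> /le_trans; apply; rewrite -div1r ler_pdivrMr //.
  have : 0 <= (x / 8) ^+ 2 * (3 / 20 - 23 / 20 * (x / 8)).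
    by rewrite mulr_ge0 ?sqr_ge0 //; lra.
  lra.
have D8 : 0 <= x / 8 <= 1 / 8 by lra.
have c8 : 0 <= 23 / 20 :> R by lra.
have := @expR_double (x / 8) (1 / 8) (23 / 20) (91 / 100) D8 c8 H8.
have -> : 2 * (x / 8) = x / 4 by field.
move=> H4; have {}H4 : expR (x / 4) <= 1 + x / 4 + 91 / 100 * (x / 4) ^+ 2.
  by apply: H4; lra.
have D4 : 0 <= x / 4 <= 1 / 4 by lra.
have c4 : 0 <= 91 / 100 :> R by lra.
have := @expR_double (x / 4) (1 / 4) (91 / 100) (84 / 100) D4 c4 H4.
have -> : 2 * (x / 4) = x / 2 by field.
move=> H2; have {}H2 : expR (x / 2) <= 1 + x / 2 + 84 / 100 * (x / 2) ^+ 2.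
  by apply: H2; lra.
have D2 : 0 <= x / 2 <= 1 / 2 by lra.
have c2 : 0 <= 84 / 100 :> R by lra.
have := @expR_double (x / 2) (1 / 2) (84 / 100) 1 D2 c2 H2.
have -> : 2 * (x / 2) = x by field.
move=> H1; have : expR x <= 1 + x + 1 * x ^+ 2 by apply: H1; lra.
by rewrite mul1r.
Qed.

(** The quadratic bound and [s^2 <= 1] show that the mean of [expR (lam s)] is at most [1 + lam m +
    lam^2 <= expR (lam m + lam^2)]. *)
Lemma hoeffding_step (X : finType) (p : X -> R) (s : X -> R) (lam : R) :
  is_dist p -> (forall x, `|s x| <= 1) -> 0 <= lam <= 1 ->
  \sum_x p x * expR (lam * (s x - \sum_y p y * s y) - lam ^+ 2) <= 1.
Proof.
move=> [p0 p1] s1 /andP[l0 l1]; set m := \sum_y p y * s y.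
have E x : expR (lam * (s x - m) - lam ^+ 2) =
    expR (lam * s x) * expR (- (lam * m + lam ^+ 2)).
  by rewrite -expRD; congr expR; ring.
under eq_bigr do rewrite E mulrA.
rewrite -mulr_suml expRN ler_pdivrMr ?expR_gt0 // mul1r.
apply: le_trans (expR_ge1Dx _).
apply: (@le_trans _ _ (\sum_x p x * (1 + lam * s x + lam ^+ 2))).
  apply: ler_sum => x _; rewrite ler_wpM2l //.
  apply: le_trans (expR_le_quad _) _.
    by rewrite normrM ger0_norm // mulr_ile1.
  rewrite lerD2l exprMn ler_piMr ?sqr_ge0 //.
  by rewrite -real_normK ?num_real // expr_le1.
apply: (@le_trans _ _ ((\sum_x p x) * (1 + lam ^+ 2) + lam * m)); last by rewrite p1; lra.
rewrite mulr_suml /m mulr_sumr -big_split; apply: ler_sum => x _ /=; lra.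
Qed.

End Hoeffding.

(** * Sums over the trajectories of a Markov chain *)

Section Chain.
Context (R : realType) (S : finType).
Implicit Types (n k K : nat).

Definition extend K (f : {ffun 'I_K -> S}) (s : S) : {ffun 'I_K.+1 -> S} :=
  [ffun i => if unlift ord_max i is Some j then f j else s].

Lemma extend_lt K (f : {ffun 'I_K.+1 -> S}) s k : (k <= K)%N ->
  extend f s (inord k) = f (inord k).
Proof.
move=> kK; rewrite ffunE.
have -> : (inord k : 'I_K.+2) = lift ord_max (inord k : 'I_K.+1).
  apply: val_inj; rewrite /= !inordK ?ltnS //; last by rewrite leqW.
  by rewrite /bump leqNgt ltnS kK.
by rewrite liftK.
Qed.

Lemma extend_last K (f : {ffun 'I_K -> S}) s : extend f s (inord K) = s.
Proof.
rewrite ffunE; have -> : (inord K : 'I_K.+1) = ord_max.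
  by apply: val_inj; rewrite /= inordK.
by rewrite unlift_none.
Qed.

Lemma sum_extend K (F : {ffun 'I_K.+1 -> S} -> R) :
  \sum_f F f = \sum_(f : {ffun 'I_K -> S}) \sum_s F (extend f s).
Proof.
rewrite pair_big /= (reindex (fun u : {ffun 'I_K -> S} * S => extend u.1 u.2)) //=.
apply: onW_bij; exists (fun f : {ffun 'I_K.+1 -> S} =>
  ([ffun j : 'I_K => f (lift ord_max j)], f ord_max)).
  move=> [f s] /=; congr (_, _); last by rewrite ffunE unlift_none.
  by apply/ffunP => j; rewrite !ffunE liftK.
move=> f; apply/ffunP => i; rewrite ffunE /=.
by case: unliftP => [j ->|->]; rewrite ?ffunE.
Qed.

Context (nu : S -> R) (step : nat -> S -> S -> R).

Fixpoint chain_law n : S -> R :=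
  if n is k.+1 then fun z' => \sum_z chain_law k z * step k z z' else nu.

Definition chain_weight K (f : {ffun 'I_K.+1 -> S}) : R :=
  nu (f (inord 0)) *
  \prod_(0 <= k < K) step k (f (inord k)) (f (inord k.+1)).

Lemma chain_weight_extend K (f : {ffun 'I_K.+1 -> S}) s :
  chain_weight (extend f s) = chain_weight f * step K (f (inord K)) s.
Proof.
rewrite /chain_weight big_nat_recr //= mulrA extend_lt // extend_lt // extend_last.
congr (_ * _ * _); rewrite !big_nat; apply: eq_bigr => k kK.
by rewrite !extend_lt // ltnW.
Qed.

Lemma chain_sum_last K (phi : S -> R) :
  \sum_(f : {ffun 'I_K.+1 -> S}) chain_weight f * phi (f (inord K)) =
  \sum_z chain_law K z * phi z.
Proof.
elim: K phi => [|K IHK] phi.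
  rewrite sum_extend (eq_bigr (fun _ => \sum_s nu s * phi s)) => [|f _].
    rewrite sumr_const card_ffun card_ord expn0; exact: mulr1n.
  apply: eq_bigr => s _; rewrite /chain_weight big_geq // mulr1.
  by rewrite !extend_last.
rewrite sum_extend.
transitivity (\sum_(f : {ffun 'I_K.+1 -> S})
    chain_weight f * \sum_s step K (f (inord K)) s * phi s).
  apply: eq_bigr => f _; rewrite mulr_sumr; apply: eq_bigr => s _.
  by rewrite chain_weight_extend extend_last mulrA.
rewrite (IHK (fun z => \sum_s step K z s * phi s)) /=.
under eq_bigr do rewrite mulr_sumr.
rewrite exchange_big /=; apply: eq_bigr => s _; rewrite mulr_suml.
by apply: eq_bigr => z _; rewrite mulrA.
Qed.

(** The steps after time [n + 1] sum to 1 and are peeled off from the end, until the trajectory ends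
    with the pair in question. *)
Lemma chain_sum_pair K n (phi : S -> S -> R) : (n < K)%N ->
  (forall k z, (k < K)%N -> \sum_z' step k z z' = 1) ->
  \sum_(f : {ffun 'I_K.+1 -> S})
    chain_weight f * phi (f (inord n)) (f (inord n.+1)) =
  \sum_z chain_law n z * \sum_z' step n z z' * phi z z'.
Proof.
elim: K => // K IHK; rewrite ltnS leq_eqVlt => /predU1P[->|nK] step1.
  rewrite -(chain_sum_last K) sum_extend; apply: eq_bigr => f _.
  rewrite mulr_sumr; apply: eq_bigr => s _.
  by rewrite chain_weight_extend extend_last extend_lt // mulrA.
rewrite -IHK // => [|k z kK]; last by rewrite step1 // leqW.
rewrite sum_extend; apply: eq_bigr => f _.
rewrite -[in RHS](mulr1 (chain_weight f)) -(step1 K (f (inord K))) //.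
rewrite mulr_sumr mulr_suml; apply: eq_bigr => s _.
by rewrite chain_weight_extend !extend_lt // ltnW.
Qed.

End Chain.

Section Trajectories.
Context (R : realType) (X A : finType) (N : nat).
Variables (p : nat -> X * A -> X -> R) (pi : nat -> X -> A -> R) (nu : X * A -> R).
Hypotheses (kp : is_kernel N p) (kpi : is_policy N pi).

Let step k (z z' : X * A) : R := p k.+1 z z'.1 * pi k.+1 z'.1 z'.2.

Lemma occ_chain_law n z : chain_law nu step n z = occ p pi nu n z.
Proof.
elim: n z => // n IHn z /=; apply: eq_bigr => z' _.
by rewrite IHn /step mulrA.
Qed.

Lemma step_sum k z (phi : X -> R) : (k < N)%N ->
  \sum_z' step k z z' * phi z'.1 = \sum_x p k.+1 z x * phi x.
Proof.
move=> kN; rewrite sum_pair; apply: eq_bigr => x _; rewrite /step /=.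
rewrite -[RHS]mulr1 -(kpi x (kN : (1 <= k.+1 <= N)%N)).2 mulr_sumr.
by apply: eq_bigr => a _; rewrite mulrAC.
Qed.

Lemma traj_prob_sum n (phi : X * A -> X -> R) : (n < N)%N ->
  \sum_(f : {ffun 'I_N.+1 -> X * A})
    traj_prob N p pi nu (fun k => f (inord k)) *
    phi (f (inord n)) (f (inord n.+1)).1 =
  \sum_z occ p pi nu n z * \sum_x p n.+1 z x * phi z x.
Proof.
move=> nN; have := @chain_sum_pair R _ nu step N n (fun z z' => phi z z'.1) nN.
rewrite /chain_weight /traj_prob => -> => [|k z kN].
  by apply: eq_bigr => z _; rewrite occ_chain_law step_sum.
under eq_bigr do rewrite -[step _ _ _]mulr1.
rewrite (step_sum z (fun=> 1) kN); under eq_bigr do rewrite mulr1.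
exact: (kp z (kN : (1 <= k.+1 <= N)%N)).2.
Qed.

End Trajectories.

(** * The finite law of the observations *)

Section FiniteLaw.
Context (R : realType) (X A : finType) (N T : nat).
Variables (p : nat -> X * A -> X -> R) (rho : X * A -> R).
Context (d : measure_display) (Omega : measurableType d) (P : probability Omega R).
Variables (W : Omega -> nat -> nat -> X * A).
Variables (f : Omega -> nat -> nat -> (X * A -> R) -> R).
Variables (pi : Omega -> nat -> nat -> X -> A -> R).
Hypothesis inter : interaction N T p rho P W f pi.
Hypothesis kp : is_kernel N p.
Hypothesis kpi : forall om t, (1 <= t <= T)%N -> is_policy N (pi om t).

Local Notation traj := {ffun 'I_N.+1 -> X * A}.
Local Notation history := {ffun 'I_T -> traj}.

Definition unroll (z : traj) (n : nat) : X * A := z (inord n).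

(** The observations of all episodes as a point of a finite type; the ordinal [s] stands for episode
    [s + 1]. *)
Definition code (om : Omega) : history :=
  [ffun s : 'I_T => [ffun n : 'I_N.+1 => W om s.+1 n]].

Definition weight (h : history) : R := fine (P [set om | code om = h]).

Lemma codeE om (i : 'I_T) n : (n <= N)%N -> unroll (code om i) n = W om i.+1 n.
Proof. by move=> nN; rewrite /unroll !ffunE inordK. Qed.

Lemma same_past_le t t' (w w' : nat -> nat -> X * A) : (t <= t')%N ->
  same_past N t' w w' -> same_past N t w w'.
Proof.
move=> tt sp s n /andP[s1 st] nN; apply: sp => //.
by rewrite s1 (leq_trans st).
Qed.

Lemma code_same om om' : code om = code om' -> same_past N T.+1 (W om) (W om').
Proof.
move=> E s n /andP[s1 sT] nN.
have sT' : (s.-1 < T)%N by rewrite -ltnS prednK.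
have := codeE om (Ordinal sT') nN; have := codeE om' (Ordinal sT') nN.
by rewrite E /= prednK // => -> ->.
Qed.

Lemma measurable_code h : measurable [set om | code om = h].
Proof.
have -> : [set om | code om = h] =
    \bigcap_(u in [set: 'I_T * 'I_N.+1]) [set om | W om u.1.+1 u.2 = h u.1 u.2].
  apply/seteqP; split=> [om /= <- [i n] _ /=|om /= H]; first by rewrite !ffunE.
  by apply/ffunP => i; apply/ffunP => n; rewrite !ffunE (H (i, n)).
apply: fin_bigcap_measurable; first exact: finite_finset.
by move=> [i n] _ /=; apply: (obs_measurable inter) => //; rewrite -ltnS ltn_ord.
Qed.

Lemma weight_ge0 h : 0 <= weight h.
Proof. by rewrite fine_ge0. Qed.

Lemma weightE h : P [set om | code om = h] = (weight h)%:E.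
Proof. by rewrite fineK // fin_num_measure //; exact: measurable_code. Qed.

Lemma P_code (B : pred history) :
  P [set om | B (code om)] = (\sum_(h | B h) weight h)%:E.
Proof.
have key (s : seq history) : uniq s ->
    measurable [set om | code om \in s] /\
    P [set om | code om \in s] = (\sum_(h <- s) weight h)%:E.
  elim: s => [_|h s IHs /= /andP[hs /IHs[ms Ps]]].
    rewrite big_nil; have -> : [set om | code om \in [::]] = set0.
      by apply/seteqP; split=> om.
    by split; [exact: measurable0|exact: measure0].
  have -> : [set om | code om \in h :: s] =
      [set om | code om = h] `|` [set om | code om \in s].
    apply/seteqP; split=> om /=; rewrite inE.
      by move=> /orP[/eqP|]; [left|right].
    by case=> [->|->]; rewrite ?eqxx ?orbT.
  have mh := measurable_code h.
  split; first exact: measurableU.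
  rewrite measureU //; first by rewrite big_cons EFinD -Ps -weightE.
  by apply/seteqP; split=> om //= [->]; rewrite (negPf hs).
have [_] := key (seq.filter B (index_enum _))
  (filter_uniq B (index_enum_uniq _)).
rewrite big_filter => <-; congr (P _); apply/seteqP.
by split=> om /=; rewrite mem_filter mem_index_enum andbT.
Qed.

Lemma sum_weight : \sum_h weight h = 1.
Proof.
apply: EFin_inj; rewrite -(P_code xpredT) -(@probability_setT _ _ _ P).
by congr (P _); apply/seteqP.
Qed.

(** One sample point per history turns functions of the observations into functions on a finite set.
    For histories that never occur the choice is arbitrary, and their weight is 0. *)
Lemma ex_rep : exists rep : history -> Omega,
  (forall om, code (rep (code om)) = code om) /\
  forall h, weight h != 0 -> code (rep h) = h.
Proof.
have [om0 _] : [set: Omega] !=set0.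
  apply/set0P/eqP => E; have := @probability_setT _ _ _ P.
  by rewrite E measure0 => -[] /eqP; rewrite eq_sym oner_eq0.
exists (fun h => xget om0 [set om | code om = h]); split=> [om|h wh].
  by apply: (@xgetPex _ om0 [set om' | code om' = code om]); exists om.
apply: (@xgetPex _ om0 [set om | code om = h]).
apply: contrapT => /forallNP E; move: wh; rewrite /weight.
have -> : [set om | code om = h] = set0 by apply/seteqP; split=> om // /E.
by rewrite measure0 eqxx.
Qed.

Variable rep : history -> Omega.
Hypothesis repK : forall h, weight h != 0 -> code (rep h) = h.

Lemma rho_seq_past t om om' : (1 <= t <= T)%N ->
  same_past N t (W om) (W om') ->
  rho_seq N p rho (pi om) t = rho_seq N p rho (pi om') t.
Proof.
case: t => // t; elim: t => // t IHt /andP[_ tT] sp.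
have tT' : (1 <= t.+1 <= T)%N by exact: ltnW.
rewrite rho_seqS // [RHS]rho_seqS // IHt //; last exact: same_past_le sp.
by rewrite (policy_past inter tT' (same_past_le (leqnSn _) sp)).
Qed.

Definition law_at om t : traj -> R := fun z =>
  traj_prob N p (pi om t) (rho_seq N p rho (pi om) t) (unroll z).

(** Discrete conditioning on the past of episode [t]. Histories are grouped by their first [t - 1]
    episodes; on a group the policy and [rho_t] are constant, and [trajectory_law] gives the
    conditional law of the next trajectory. *)
Lemma tower t (F : Omega -> (nat -> X * A) -> R) : (1 <= t <= T)%N ->
  (forall om om', same_past N t (W om) (W om') -> F om = F om') ->
  (forall om z z', (forall n, (n <= N)%N -> z n = z' n) -> F om z = F om z') ->
  \sum_h weight h * F (rep h) (W (rep h) t) =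
  \sum_h weight h * \sum_z law_at (rep h) t z * F (rep h) (unroll z).
Proof.
move=> tT Fpast Floc.
have iT : (t.-1 < T)%N by case/andP: tT => t1 tT; rewrite prednK.
pose i0 := Ordinal iT; have i0E : i0.+1 = t by case/andP: tT => t1 _; rewrite /= prednK.
(* Episodes from [t] on are erased instead of removed, so that the type does not depend on [t]. *)
pose key (h : history) : {ffun 'I_T -> option traj} :=
  [ffun i : 'I_T => if (i.+1 < t)%N then Some (h i) else None].
have keyP om om' : key (code om) = key (code om') <->
    same_past N t (W om) (W om').
  split=> [E s n /andP[s1 st] nN|sp].
    have sT : (s.-1 < T)%N by rewrite prednK // ltnW // (leq_trans st) //; case/andP: tT.
    have := congr1 (fun k : {ffun 'I_T -> option traj} => k (Ordinal sT)) E.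
    rewrite !ffunE /= prednK // st => -[] E'.
    have := codeE om (Ordinal sT) nN; have := codeE om' (Ordinal sT) nN.
    rewrite /= prednK // => <- <-; congr unroll.
    by move: E'; rewrite !ffunE /= prednK.
  apply/ffunP => i; rewrite !ffunE; case: ifP => // it.
  congr Some; apply/ffunP => n; rewrite !ffunE; apply: sp; first by rewrite it.
  by rewrite -ltnS ltn_ord.
rewrite (partition_big key xpredT) //= [RHS](partition_big key xpredT) //=.
apply: eq_bigr => k _.
(* A group without a history of positive weight contributes 0 to both sides. *)
have [h0 /andP[/eqP kh0 wh0]|none] :=
    pickP (fun h => (key h == k) && (weight h != 0)); last first.
  rewrite !big1 // => h /eqP kh; have := none h.
    by rewrite kh eqxx /= => /negbFE/eqP ->; rewrite mul0r.
  by rewrite kh eqxx /= => /negbFE/eqP ->; rewrite mul0r.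
pose om0 := rep h0.
have past h : key h = k -> weight h != 0 -> same_past N t (W (rep h)) (W om0).
  by move=> kh wh; apply/keyP; rewrite !repK // kh kh0.
have lawE h : key h = k -> weight h != 0 -> law_at (rep h) t = law_at om0 t.
  move=> kh wh; have sp := past h kh wh; rewrite /law_at.
  by rewrite (rho_seq_past tT sp) (policy_past inter tT sp).
transitivity (\sum_(h | key h == k) weight h * F om0 (unroll (h i0))).
  apply: eq_bigr => h /eqP kh.
  have [->|wh] := eqVneq (weight h) 0; first by rewrite !mul0r.
  rewrite (Fpast _ _ (past h kh wh)); congr (_ * _); apply: Floc => n nN.
  by rewrite -i0E -codeE // repK.
transitivity ((\sum_(h | key h == k) weight h) *
    \sum_z law_at om0 t z * F om0 (unroll z)); last first.
  rewrite mulr_suml; apply: eq_bigr => h /eqP kh.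
  have [->|wh] := eqVneq (weight h) 0; first by rewrite !mul0r.
  by rewrite (lawE h kh wh) (Fpast _ _ (past h kh wh)).
rewrite (partition_big (fun h : history => h i0) xpredT) //= mulr_sumr.
apply: eq_bigr => z _.
transitivity ((\sum_(h | (key h == k) && (h i0 == z)) weight h) * F om0 (unroll z)).
  by rewrite mulr_suml; apply: eq_bigr => h /andP[_ /eqP ->].
rewrite mulrA; congr (_ * _); apply: EFin_inj; rewrite EFinM -!P_code.
have -> : [set om | key (code om) == k] = [set om | same_past N t (W om) (W om0)].
  apply/seteqP; split=> om /=.
    by move=> /eqP E; apply/keyP; rewrite E repK.
  by move=> /keyP ->; rewrite repK // kh0.
rewrite -(trajectory_law inter) //; congr (P _); apply/seteqP; split=> om /=.
  move=> /andP[/eqP E /eqP E']; split; first by apply/keyP; rewrite E repK.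
  by move=> n nN; rewrite -E' codeE // i0E.
case=> /keyP -> E; rewrite repK // kh0 eqxx /=; apply/eqP/ffunP => n.
rewrite !ffunE i0E E; last by rewrite -ltnS ltn_ord.
by rewrite /unroll inord_val.
Qed.

Lemma law_at_sum om t n (phi : X * A -> X -> R) : (1 <= t <= T)%N -> (n < N)%N ->
  \sum_z law_at om t z * phi (unroll z n) (unroll z n.+1).1 =
  \sum_z occ p (pi om t) (rho_seq N p rho (pi om) t) n z *
    \sum_x p n.+1 z x * phi z x.
Proof.
move=> tT nN.
exact: (@traj_prob_sum _ _ _ _ _ _ (rho_seq N p rho (pi om) t) kp (kpi om tT) n phi nN).
Qed.

Lemma weight_markov (phi : history -> R) (a : R) : 0 < a -> (forall h, 0 <= phi h) ->
  \sum_(h | a <= phi h) weight h <= (\sum_h weight h * phi h) / a.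
Proof.
move=> a0 phi0; rewrite ler_pdivlMr // mulr_suml [leRHS](bigID (fun h => a <= phi h)) /=.
rewrite -[leLHS]addr0 lerD //; last first.
  by apply: sumr_ge0 => h _; rewrite mulr_ge0 ?weight_ge0.
by apply: ler_sum => h ah; rewrite ler_wpM2l ?weight_ge0.
Qed.

End FiniteLaw.

(** * Concentration *)

Section Concentration.
Context (R : realType) (X A : finType) (N : nat).
Implicit Types (w : nat -> nat -> X * A) (s : X -> R) (pz : X -> R).

(* The increments of the first [k] visits of [z] at step [n], so that one
   supermartingale controls all episodes in which [z] has been visited [k] times. *)
Definition exponent w (n : nat) (z : X * A) s (k : nat) (lam m : R) (t : nat) : R :=
  \sum_(1 <= u < t)
    if (w u n == z) && (visits w u n z < k)%N
    then lam * (s (w u n.+1).1 - m) - lam ^+ 2 else 0.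

(** With the cap equal to the number of visits before episode [t], no later visit is counted, so the
    final value is the centred sum as it stood at episode [t]. *)
Lemma exponent_final w n z s lam m t T : (1 <= t <= T)%N ->
  exponent w n z s (visits w t n z) lam m T.+1 =
  lam * (\sum_x (trans_visits w t n z x)%:R * s x - (visits w t n z)%:R * m) -
  lam ^+ 2 * (visits w t n z)%:R.
Proof.
move=> /andP[t1 tT]; rewrite /exponent (@big_cat_nat _ _ _ t) ?leqW //=.
rewrite [X in _ + X]big_nat [X in _ + X]big1 ?addr0 => [|u /andP[tu _]]; last first.
  by rewrite ltnNge (visits_le _ _ _ tu) andbF.
transitivity (\sum_(1 <= u < t) (lam * ((w u n == z)%:R * s (w u n.+1).1 -
    (w u n == z)%:R * m) - lam ^+ 2 * (w u n == z)%:R)).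
  rewrite !big_nat; apply: eq_bigr => u /andP[u1 ut].
  have [wu|] := eqVneq (w u n) z; last by rewrite /= !mul0r subrr !mulr0 subrr.
  have := visits_le w n z ut; rewrite visitsS // wu eqxx addn1 => -> /=.
  by rewrite !mul1r mulr1.
rewrite sumrB -!mulr_sumr sumrB -mulr_suml.
have vE : \sum_(1 <= u < t) (w u n == z)%:R = (visits w t n z)%:R :> R.
  by rewrite /visits natr_sum.
rewrite vE; congr (_ * (_ - _) - _).
under [RHS]eq_bigr do rewrite /trans_visits natr_sum mulr_suml.
rewrite exchange_big /=; apply: eq_bigr => u _.
rewrite (bigD1 (w u n.+1).1) //= eqxx andbT big1 ?addr0 // => x /negPf.
by rewrite eq_sym => ->; rewrite andbF mul0r.
Qed.

Definition sign_of (b : {ffun X -> bool}) (x : X) : R := if b x then 1 else -1.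

Lemma l1dist_sign (u v : X -> R) :
  exists b, l1dist u v = \sum_x (u x - v x) * sign_of b x.
Proof.
exists [ffun x => 0 <= u x - v x]; apply: eq_bigr => x _; rewrite /sign_of ffunE.
have [H|H] := leP 0 (u x - v x) => /=; first by rewrite mulr1 ger0_norm.
by rewrite mulrN1 ltr0_norm.
Qed.

Lemma dist_card1 (u v : X -> R) : is_dist u -> is_dist v -> (#|X| <= 1)%N ->
  l1dist u v = 0.
Proof.
move=> du dv c1; rewrite /l1dist /norm1 big1 // => x _.
have E (q : X -> R) : is_dist q -> q x = 1.
  case=> _ <-; rewrite (bigD1 x) //= big1 ?addr0 // => y /eqP yx.
  by case: yx; apply: (fintype_le1P c1).
by rewrite !E // subrr normr0.
Qed.

(** With [V] visits and distance [D], some sign vector gives the exponent [lam V D - lam^2 V]; for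
    [lam = C / (2 sqrt V)] and [D sqrt V > C] this is at least [C^2 / 4]. An unvisited pair cannot
    be inaccurate: with several states its bonus is at least 2. *)
Lemma inaccurate_exponent w (C : R) (p : nat -> X * A -> X -> R) t T n z :
  (1 <= t <= T)%N -> is_dist (p n.+1 z) -> ((1 < #|X|)%N -> 2 <= C) -> 0 <= C ->
  C / Num.sqrt (maxn 1 (visits w t n z))%:R <
    l1dist (phat R w t n.+1 z) (p n.+1 z) ->
  exists (k : 'I_T) b,
    C ^+ 2 / 4 <= exponent w n z (sign_of b) k.+1
      (Num.min 1 (C / (2 * Num.sqrt k.+1%:R)))
      (\sum_x p n.+1 z x * sign_of b x) T.+1.
Proof.
move=> tT dp C2 C0; have dq := phat_dist R w t n z.
have [c1|c1] := leqP #|X| 1.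
  by rewrite (dist_card1 dq dp c1) ltNge divr_ge0 // sqrtr_ge0.
have le2 := l1dist_le2 dq dp.
have [v0|v0] := posnP (visits w t n z).
  by rewrite v0 sqrtr1 divr1; have := C2 c1; lra.
rewrite (maxn_idPr v0).
have kT : ((visits w t n z).-1 < T)%N.
  have := visits_leq w t n z; case/andP: tT => t1 tT.
  by rewrite prednK //; move=> /leq_trans; apply; rewrite (leq_trans (leq_pred _)).
have [b Eb] := l1dist_sign (phat R w t n.+1 z) (p n.+1 z).
set D := l1dist _ _ in le2 Eb *; move=> H.
exists (Ordinal kT), b; rewrite /= prednK // exponent_final //.
have vn0 : (visits w t n z)%:R != 0 :> R by rewrite pnatr_eq0 -lt0n.
have -> : \sum_x (trans_visits w t n z x)%:R * sign_of b x -
    (visits w t n z)%:R * (\sum_x p n.+1 z x * sign_of b x) =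
    (visits w t n z)%:R * D.
  rewrite Eb !mulr_sumr -sumrB; apply: eq_bigr => x _.
  rewrite phatE -?lt0n //; move: vn0; move: ((visits _ _ _ _)%:R : R) => V V0.
  by field.
have v0' : 0 < (visits w t n z)%:R :> R by rewrite ltr0n.
have := sqr_sqrtr (ltW v0').
have : 0 < Num.sqrt (visits w t n z)%:R :> R by rewrite sqrtr_gt0.
move: H; move: (Num.sqrt _) => q H q0 <-.
have CD : C < D * q by rewrite -ltr_pdivrMr.
have q0' : q != 0 by exact: lt0r_neq0.
(* The cap at 1 is inactive: [D <= 2] and [C < D q] give [C <= 2 q]. *)
have -> : Num.min 1 (C / (2 * q)) = C / (2 * q).
  apply/min_idPr; rewrite ler_pdivrMr ?mulr_gt0 // mul1r.
  by apply: (le_trans (ltW CD)); rewrite ler_wpM2r // ltW.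
have -> : C / (2 * q) * (q ^+ 2 * D) - (C / (2 * q)) ^+ 2 * q ^+ 2 =
    C / 2 * (D * q) - C ^+ 2 / 4 by field.
have : C / 2 * C <= C / 2 * (D * q) by rewrite ler_wpM2l ?divr_ge0 // ltW.
lra.
Qed.

End Concentration.

(** * Probability of the two bad events *)

Section HighProbability.
Context (R : realType) (X A : finType) (N T : nat).
Variables (p : nat -> X * A -> X -> R) (rho : X * A -> R).
Context (d : measure_display) (Omega : measurableType d) (P : probability Omega R).
Variables (W : Omega -> nat -> nat -> X * A).
Variables (f : Omega -> nat -> nat -> (X * A -> R) -> R).
Variables (pi : Omega -> nat -> nat -> X -> A -> R).
Hypothesis inter : interaction N T p rho P W f pi.
Hypothesis kp : is_kernel N p.
Hypothesis kpi : forall om t, (1 <= t <= T)%N -> is_policy N (pi om t).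
Hypothesis drho : is_dist rho.
Variable rep : {ffun 'I_T -> {ffun 'I_N.+1 -> X * A}} -> Omega.
Hypothesis repK : forall h, weight P W h != 0 -> code N T W (rep h) = h.

Local Notation weight := (@weight R X A N T d Omega P W).

Lemma visits_past t n z (w w' : nat -> nat -> X * A) : (n <= N)%N ->
  same_past N t w w' -> visits w t n z = visits w' t n z.
Proof.
move=> nN sp; rewrite /visits !big_nat; apply: eq_bigr => s st.
by rewrite sp.
Qed.

(** Given the past, the occupancy at time [n] is the law of the observed pair. In expectation it may
    be replaced by the indicator of that pair, and the resulting sum is bounded on every path. *)
Lemma expected_visit_weight :
  \sum_h weight h * (\sum_(1 <= t < T.+1) \sum_(0 <= n < N) \sum_z
    occ p (pi (rep h) t) (rho_seq N p rho (pi (rep h)) t) n z /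
    Num.sqrt (maxn 1 (visits (W (rep h)) t n z))%:R) <=
  3 * N%:R * #|{: X * A}|%:R * Num.sqrt T%:R.
Proof.
pose iv om t n z : R := (Num.sqrt (maxn 1 (visits (W om) t n z))%:R)^-1.
have E t n : (1 <= t <= T)%N -> (n < N)%N ->
    \sum_h weight h * (\sum_z
      occ p (pi (rep h) t) (rho_seq N p rho (pi (rep h)) t) n z * iv (rep h) t n z) =
    \sum_h weight h * iv (rep h) t n (W (rep h) t n).
  move=> tT nN; have nN' := ltnW nN.
  rewrite (tower inter repK (F := fun om z => iv om t n (z n)) tT); first last.
  - by move=> om z z' zz; rewrite zz.
  - move=> om om' sp; apply/funext => z; rewrite /iv.
    by rewrite (visits_past _ nN' sp).
  apply: eq_bigr => h _; congr (_ * _).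
  have := law_at_sum rho kp kpi (rep h) (fun z _ => iv (rep h) t n z) tT nN.
  move=> ->; apply: eq_bigr => z _; rewrite -mulr_suml (kp z _).2 ?mul1r //.
have -> : \sum_h weight h * (\sum_(1 <= t < T.+1) \sum_(0 <= n < N) \sum_z
    occ p (pi (rep h) t) (rho_seq N p rho (pi (rep h)) t) n z /
    Num.sqrt (maxn 1 (visits (W (rep h)) t n z))%:R) =
  \sum_h weight h * (\sum_(0 <= n < N) \sum_z \sum_(1 <= t < T.+1)
    (W (rep h) t n == z)%:R / Num.sqrt (maxn 1 (visits (W (rep h)) t n z))%:R).
  transitivity (\sum_(1 <= t < T.+1) \sum_(0 <= n < N)
    \sum_h weight h * iv (rep h) t n (W (rep h) t n)).
    under eq_bigr do rewrite mulr_sumr.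
    rewrite exchange_big /= !big_nat; apply: eq_bigr => t tT.
    under eq_bigr do rewrite mulr_sumr.
    rewrite exchange_big /= !big_nat; apply: eq_bigr => n nN.
    exact: E.
  under [RHS]eq_bigr do rewrite mulr_sumr.
  rewrite exchange_big [RHS]exchange_big /=; apply: eq_bigr => n _.
  rewrite exchange_big; apply: eq_bigr => h _ /=.
  rewrite -mulr_sumr; congr (_ * _); rewrite exchange_big; apply: eq_bigr => t _ /=.
  rewrite (bigD1 (W (rep h) t n)) //= eqxx mul1r big1 ?addr0 // => z /negPf.
  by rewrite eq_sym => ->; rewrite mul0r.
set c := 3 * N%:R * #|{: X * A}|%:R * Num.sqrt T%:R.
have -> : c = \sum_h weight h * c by rewrite -mulr_suml (sum_weight inter) mul1r.
apply: ler_sum => h _.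
rewrite ler_wpM2l ?weight_ge0 //.
by apply: (sum_visit_sqrt_le R (W (rep h)) N (t := T.+1)); rewrite leqnn.
Qed.

(** Whether a visit is counted is known before its transition is drawn. A counted visit multiplies
    the conditional mean by at most 1, by Hoeffding's bound, and an uncounted one leaves it
    unchanged. *)
Lemma supermartingale n z (s : X -> R) k (lam : R) t : (n < N)%N ->
  (forall x, `|s x| <= 1) -> 0 <= lam <= 1 -> (1 <= t <= T.+1)%N ->
  \sum_h weight h * expR (exponent (W (rep h)) n z s k lam
    (\sum_x p n.+1 z x * s x) t) <= 1.
Proof.
move=> nN s1 lam1; set m := \sum_x p n.+1 z x * s x.
case: t => // t; elim: t => [_|t IHt tT].
  under eq_bigr do rewrite /exponent big_geq // expR0 mulr1.
  by rewrite (sum_weight inter).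
have tT' : (1 <= t.+1 <= T)%N by [].
have tT'' : (1 <= t.+1 <= T.+1)%N by exact: ltnW.
apply: le_trans (IHt tT'').
pose inc om (z' : X * A) (x : X) : R :=
  if (z' == z) && (visits (W om) t.+1 n z < k)%N
  then lam * (s x - m) - lam ^+ 2 else 0.
have -> : \sum_h weight h * expR (exponent (W (rep h)) n z s k lam m t.+2) =
    \sum_h weight h * (expR (exponent (W (rep h)) n z s k lam m t.+1) *
      expR (inc (rep h) (W (rep h) t.+1 n) (W (rep h) t.+1 n.+1).1)).
  by apply: eq_bigr => h _; rewrite -expRD /exponent big_nat_recr.
rewrite (tower inter repK (F := fun om y => expR (exponent (W om) n z s k lam m t.+1) *
     expR (inc om (y n) (y n.+1).1)) tT'); first last.
- by move=> om y y' yy; rewrite !yy // ltnW.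
- move=> om om' sp; apply/funext => y; congr (expR _ * expR _); last first.
    by rewrite /inc (visits_past _ (ltnW nN) sp).
  rewrite /exponent !big_nat; apply: eq_bigr => u /andP[u1 ut].
  rewrite !sp ?u1 //; last exact: ltnW.
  by rewrite (visits_past _ (ltnW nN) (same_past_le (ltnW ut) sp)).
apply: ler_sum => h _; rewrite ler_wpM2l ?weight_ge0 //.
under eq_bigr do rewrite mulrCA.
rewrite -mulr_sumr ler_piMr ?expR_ge0 //.
have := law_at_sum rho kp kpi (rep h) (fun z' x => expR (inc (rep h) z' x)) tT' nN.
move=> ->.
have docc : is_dist (occ p (pi (rep h) t.+1) (rho_seq N p rho (pi (rep h)) t.+1) n).
  apply: (@occ_dist _ _ _ N) => //; [exact: kpi| |exact: ltnW].
  elim: (t) tT' => [_|u IHu uT]; first exact: drho.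
  have uT' : (1 <= u.+1 <= T)%N by exact: ltnW.
  rewrite rho_seqS //; apply: (@occ_dist _ _ _ N) => //; first exact: kpi.
  exact: IHu.
apply: sum_weight_le => // z'.
have dp := kp z' (nN : (1 <= n.+1 <= N)%N).
rewrite /inc; have [->|_] := eqVneq z' z; last first.
  by under eq_bigr do rewrite /= expR0 mulr1; rewrite dp.2.
case: ltnP => _ /=; last by under eq_bigr do rewrite expR0 mulr1; rewrite (kp z _).2.
by apply: hoeffding_step => //; exact: kp.
Qed.

Definition inaccurate (delta : R) (om : Omega) : Prop :=
  exists t n z, [/\ (1 <= t <= T)%N, (n < N)%N &
    bonus N T delta (W om) t n z < l1dist (phat R (W om) t n.+1 z) (p n.+1 z)].

Lemma sum_weight_union (I : finType) (B : pred {ffun 'I_T -> {ffun 'I_N.+1 -> X * A}})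
    (B' : I -> pred {ffun 'I_T -> {ffun 'I_N.+1 -> X * A}}) :
  (forall h, B h -> exists i, B' i h) ->
  \sum_(h | B h) weight h <= \sum_i \sum_(h | B' i h) weight h.
Proof.
move=> BB; under [leRHS]eq_bigr do rewrite big_mkcond.
rewrite exchange_big big_mkcond; apply: ler_sum => h _ /=.
have w0 := weight_ge0 P W h.
case: ifP => [/BB[i Bi]|_]; last by apply: sumr_ge0 => i _; case: ifP.
by rewrite (bigD1 i) //= Bi lerDl; apply: sumr_ge0 => j _; case: ifP.
Qed.

(** One Markov inequality for each time, pair, sign vector and visit count; there are [2 ^ #|X|]
    sign vectors. *)
Lemma inaccurate_union (delta : R) : ((1 < #|X|)%N -> 2 <= Cdelta X A N T delta) ->
  \sum_(h | `[< inaccurate delta (rep h) >]) weight h <=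
  (N * #|{: X * A}| * 2 ^ #|X| * T)%:R * expR (- (Cdelta X A N T delta ^+ 2 / 4)).
Proof.
set C := Cdelta X A N T delta => C2; have C0 : 0 <= C := Cdelta_ge0 X A N T delta.
pose Z (i : 'I_N * (X * A) * {ffun X -> bool} * 'I_T) h : R :=
  let: (n, z, b, k) := i in
  expR (exponent (W (rep h)) n z (sign_of R b) k.+1
      (Num.min 1 (C / (2 * Num.sqrt k.+1%:R)))
      (\sum_x p n.+1 z x * sign_of R b x) T.+1).
apply: le_trans (@sum_weight_union _ _ (fun i h => expR (C ^+ 2 / 4) <= Z i h) _) _.
  move=> h /asboolP[t [n [z [tT nN bad]]]].
  rewrite /bonus nN in bad.
  have dp := kp z (nN : (1 <= n.+1 <= N)%N).
  have [k [b H]] := inaccurate_exponent tT dp C2 C0 bad.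
  by exists (Ordinal nN, z, b, k); rewrite /Z /= ler_expR.
apply: (@le_trans _ _ (\sum_(i : 'I_N * (X * A) * {ffun X -> bool} * 'I_T)
    expR (- (C ^+ 2 / 4)))); last first.
  rewrite sumr_const !card_prod card_ffun card_bool !card_ord.
  by rewrite -[leLHS]mulr_natl.
apply: ler_sum => -[[[n z] b] k] _.
apply: le_trans (weight_markov P W _ _) _ => //.
- exact: expR_gt0.
- by move=> h; rewrite expR_ge0.
rewrite expRN ler_pdivrMr ?expR_gt0 // mulVf ?gt_eqF ?expR_gt0 //.
apply: supermartingale => //.
- by move=> x; rewrite /sign_of; case: ifP => _; rewrite ?normrN normr1.
- by rewrite le_min ler01 divr_ge0 ?mulr_ge0 ?sqrtr_ge0 //= ge_min lexx.
by rewrite leqnn.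
Qed.

(** With [u = expR (- (L / 2))] the exponential is [u ^ #|X|], and [u^2] is [delta] divided by the
    number of remaining cases. As [L >= 2] forces [2 u <= 1], two or more states give
    [(2 u) ^ #|X| <= 4 u^2], whence [4 delta]. *)
Lemma inaccurate_whp (delta : R) : (0 < N)%N -> (0 < T)%N -> 0 < delta ->
  2 <= logterm X A N T delta ->
  \sum_(h | `[< inaccurate delta (rep h) >]) weight h <= 4 * delta.
Proof.
move=> N0 T0 delta0 L2; set L := logterm X A N T delta in L2.
have /card_gt0P[[x0 a0] _] := dist_card drho.
have X0 : (0 < #|X|)%N by apply/card_gt0P; exists x0.
have A0 : (0 < #|A|)%N by apply/card_gt0P; exists a0.
have C2E : Cdelta X A N T delta ^+ 2 = 2 * #|X|%:R * L.
  by rewrite sqr_sqrtr // mulr_ge0 ?mulr_ge0 // (le_trans _ L2).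
(* A single state would leave [2 u] to the first power only, but then all kernels coincide. *)
have [c1|c1] := leqP #|X| 1.
  rewrite big1 ?mulr_ge0 ?ltW // => h /asboolP[t [n [z [tT nN]]]].
  rewrite (dist_card1 (phat_dist _ _ _ _ _) (kp z _) c1) //.
  by rewrite ltNge bonus_ge0.
have X2 : 2 <= #|X|%:R :> R by rewrite ler_nat.
apply: le_trans (inaccurate_union _) _.
  move=> _; rewrite -(@ler_pXn2r _ 2) ?nnegrE ?Cdelta_ge0 // C2E.
  have : 2 * 2 <= #|X|%:R * L by rewrite ler_pM.
  lra.
rewrite C2E; set u := expR (- (L / 2)).
have -> : expR (- (2 * #|X|%:R * L / 4)) = u ^+ #|X|.
  by rewrite /u -expRM_natl; congr expR; field.
have u0 : 0 <= u by rewrite expR_ge0.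
have u1 : 2 * u <= 1.
  have : u * (1 + L / 2) <= u * expR (L / 2) by rewrite ler_wpM2l // expR_ge1Dx.
  rewrite /u expRN mulVf ?gt_eqF ?expR_gt0 // -expRN -/u => H.
  have : u * 2 <= u * (1 + L / 2) by rewrite ler_wpM2l //; lra.
  lra.
have u2 : u ^+ 2 = delta / (#|X|%:R * #|A|%:R * N%:R * T%:R).
  rewrite /u -expRM_natl.
  have -> : 2 * - (L / 2) = - L by field.
  rewrite expRN /L /logterm lnK ?invf_div //.
  by rewrite posrE divr_gt0 // !mulr_gt0 // ltr0n.
have pw : 2 ^+ #|X| * u ^+ #|X| <= 4 * u ^+ 2.
  rewrite -exprMn; apply: (@le_trans _ _ ((2 * u) ^+ 2)).
    by rewrite ler_wiXn2l // mulr_ge0.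
  by rewrite exprMn; lra.
rewrite card_prod !natrM natrX.
have -> : N%:R * (#|X|%:R * #|A|%:R) * 2 ^+ #|X| * T%:R * u ^+ #|X| =
   #|X|%:R * #|A|%:R * N%:R * T%:R * (2 ^+ #|X| * u ^+ #|X|) :> R by ring.
have Q0 : 0 < #|X|%:R * #|A|%:R * N%:R * T%:R :> R by rewrite !mulr_gt0 // ltr0n.
apply: le_trans (ler_wpM2l (ltW Q0) pw) _; rewrite u2.
by rewrite le_eqVlt; apply/orP; left; apply/eqP; field; rewrite ?gt_eqF ?ltr0n.
Qed.

End HighProbability.

(** * From the gradient bound to explicit constants *)

Section GradientBound.
Context (R : realType).

Lemma lne_bound (r c : R) : (`|lne r%:E| <= c%:E)%E -> 0 < r /\ `|ln r| <= c.
Proof.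
rewrite /lne; case: ifP => [//|/negbT]; rewrite -ltNge => r0.
by rewrite abse_EFin lee_fin.
Qed.

Lemma lne_bound1 (r c : R) : (`|lne r%:E + 1| <= c%:E)%E ->
  0 < r /\ `|ln r + 1| <= c.
Proof.
rewrite /lne; case: ifP => [//|/negbT]; rewrite -ltNge => r0.
by rewrite -EFinD abse_EFin lee_fin.
Qed.

Lemma norm1oo_ge (S : finType) (N : nat) (v : nat -> S -> \bar R) (c : \bar R) n s :
  (norm1oo N v <= c)%E -> (n <= N)%N -> (`|v n s| <= c)%E.
Proof.
move=> H nN; apply: le_trans H; rewrite /norm1oo.
have max0 m : (0 <= \big[maxe/0]_s `|v m s|)%E by exact: bigmax_ge_id.
rewrite (bigD1_seq n) ?iota_uniq ?mem_index_iota //=.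
apply: (@le_trans _ _ (\big[maxe/0]_s `|v n s|)%E).
  exact: (le_bigmax 0%E (fun s => `|v n s|%E) s).
by rewrite leeDl // sume_ge0.
Qed.

Context (X A : finType) (N : nat) (dv : divergence).
Implicit Types (mu : nat -> X * A -> R) (pi : nat -> X -> A -> R).

(** [lne] is infinite at numbers that are not positive, so a finite gradient norm forces
    positivity. *)
Lemma grad_positive mu pi (Psi : R) : (norm1oo N (grad_psi dv mu pi) <= Psi%:E)%E ->
  positive N dv mu pi.
Proof.
move=> H n z nN; have := norm1oo_ge z H nN; rewrite /grad_psi.
case: dv => [/lne_bound1[]//|]; case: eqVneq => _ => [/lne_bound1[]//|/lne_bound[]//].
Qed.

(** The derivative of [m ln m] is [ln m + 1], hence the additional 1. *)
Lemma grad_logref mu pi (Psi : R) n z :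
  (norm1oo N (grad_psi dv mu pi) <= Psi%:E)%E -> (n <= N)%N ->
  `|logref dv mu pi n z| <= Psi + 1.
Proof.
move=> H nN; have := norm1oo_ge z H nN; rewrite /grad_psi /logref.
have K (x : R) : `|x + 1| <= Psi -> `|x| <= Psi + 1.
  by rewrite !ler_norml; lra.
case: dv => [/lne_bound1[_]|]; first exact: K.
by case: eqVneq => _ => [/lne_bound1[_]|/lne_bound[_]]; [exact: K|lra].
Qed.

(* If the gradient vanished, every entry of the initial law would be 1/e, which
   is impossible because e is not an integer. *)
Lemma grad_norm_gt0 mu pi (Psi : R) : is_dist (mu 0%N) ->
  (norm1oo N (grad_psi dv mu pi) <= Psi%:E)%E -> 0 < Psi.
Proof.
move=> [_ mu1] H; rewrite ltNge; apply/negP => Psi0.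
have E z : mu 0%N z = expR (-1).
  have : (`|lne (mu 0%N z)%:E + 1| <= Psi%:E)%E.
    by have := norm1oo_ge z H (leq0n N); rewrite /grad_psi; case: dv.
  case/lne_bound1 => m0 lm.
  have : ln (mu 0%N z) + 1 = 0.
    by apply/eqP; rewrite -normr_eq0 eq_le normr_ge0 (le_trans lm).
  move=> /eqP; rewrite addr_eq0 => /eqP <-; by rewrite lnK.
move: mu1; rewrite (eq_bigr _ (fun z _ => E z)) sumr_const expRN -[LHS]mulr_natl.
move=> /(congr1 (fun x => x * expR 1)); rewrite mulfVK ?mul1r ?gt_eqF ?expR_gt0 // => eE.
have e2 : 2 < expR 1 :> R.
  by have := @expR_gt1Dx R 1; rewrite oner_eq0 => /(_ isT); rewrite -natr1.
have e3 : expR 1 < 3 :> R.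
  have q0 : `|1 / 4| <= 1 :> R by rewrite ger0_norm; lra.
  have := expR_le_quad q0 => q1.
  have -> : expR 1 = expR (1 / 4) ^+ 4 :> R.
    by rewrite -expRM_natl; congr expR; field.
  apply: (@le_lt_trans _ _ ((1 + 1 / 4 + (1 / 4) ^+ 2) ^+ 4)); last by lra.
  by apply: lerXn2r => //; rewrite nnegrE ?expR_ge0 //; lra.
move: e2 e3; rewrite -eE !ltr_nat; lia.
Qed.

End GradientBound.

Section Growth.
Context (R : realType).

(* [q] stands for T^(1/4) and [L] for the logarithm. *)
Lemma regret_growth (q L n1 N l gamma alpha Psi C s K XA Sr SV c2 c3 c4 : R) :
  1 <= q -> 1 <= L -> 0 <= n1 -> 0 <= N -> 0 <= l -> 0 <= gamma -> alpha < 1 ->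
  0 <= Psi -> 0 <= C -> C <= s * L -> 0 <= K -> 0 <= XA ->
  Sr = (2 + (2 + n1 * C) * (C * (K * q ^+ 2))) / (1 - alpha) ->
  SV = 2 * Sr + 6 * N * XA * q ^+ 2 ->
  c2 = (2 + (2 + n1 * s) * (s * K)) / (1 - alpha) ->
  c3 = 2 * c2 + 6 * N * XA ->
  c4 = l + l * N * s ->
  l * N * (2 + n1 * C) * (C * (K * q ^+ 2)) + (l * N + gamma) * Sr +
  2 * (l + l * N * C) * n1 * (SV + 1) + q ^+ 4 * n1 ^+ 3 * (l + l * N * C) ^+ 2 * q^-1 +
  n1 * Psi * (2 + SV) / q^-1 <=
  (l * N * (2 + n1 * s) * (s * K) + (l * N + gamma) * c2 + 2 * c4 * n1 * (c3 + 1) +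
   n1 ^+ 3 * c4 ^+ 2 + n1 * Psi * (2 + c3)) * (L ^+ 3 * q ^+ 3).
Proof.
move=> q1 L1 n10 N0 l0 g0 a1 Psi0 C0 CL K0 XA0 SrE SVE c2E c3E c4E.
have q0 : 0 < q by lra.
have q0' := ltW q0.
have L0 : 0 <= L by lra.
have s0 : 0 <= s by rewrite -(@pmulr_lge0 _ L) ?(le_trans C0) //; lra.
have a0 : 0 <= 1 - alpha by lra.
have q2 : 1 <= q ^+ 2 by rewrite exprn_ege1.
have q3 : 1 <= q ^+ 3 by rewrite exprn_ege1.
have q23 : q ^+ 2 <= q ^+ 3 by rewrite ler_weXn2l.
have L2 : 1 <= L ^+ 2 by rewrite exprn_ege1.
have L3 : 1 <= L ^+ 3 by rewrite exprn_ege1.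
have LL2 : L <= L ^+ 2 by rewrite -{1}(expr1 L) ler_weXn2l.
have L23 : L ^+ 2 <= L ^+ 3 by rewrite ler_weXn2l.
have q20 : 0 <= q ^+ 2 by lra.
have q30 : 0 <= q ^+ 3 by lra.
have L20 : 0 <= L ^+ 2 by lra.
have L2q2 : 1 <= L ^+ 2 * q ^+ 2 by rewrite mulr_ege1.
have LQ : L ^+ 2 * q ^+ 2 <= L ^+ 3 * q ^+ 3 by rewrite ler_pM.
have LQ' : L ^+ 2 * q ^+ 3 <= L ^+ 3 * q ^+ 3 by rewrite ler_pM.
have LQ1 : 1 <= L ^+ 3 * q ^+ 3 by rewrite mulr_ege1.
have b1 : C * (K * q ^+ 2) <= s * K * (L * q ^+ 2).
  have -> : s * K * (L * q ^+ 2) = s * L * (K * q ^+ 2) by ring.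
  by rewrite ler_wpM2r // mulr_ge0 //.
have b0 : 0 <= C * (K * q ^+ 2) by rewrite mulr_ge0 // mulr_ge0.
have d1' : 2 + n1 * C <= (2 + n1 * s) * L.
  by have := ler_wpM2l n10 CL; lra.
have d0 : 0 <= 2 + n1 * C by rewrite addr_ge0 // mulr_ge0.
have db : (2 + n1 * C) * (C * (K * q ^+ 2)) <=
    (2 + n1 * s) * (s * K) * (L ^+ 2 * q ^+ 2).
  have -> : (2 + n1 * s) * (s * K) * (L ^+ 2 * q ^+ 2) =
    (2 + n1 * s) * L * (s * K * (L * q ^+ 2)) by ring.
  by rewrite ler_pM.
have Sr1 : Sr <= c2 * (L ^+ 2 * q ^+ 2).
  rewrite SrE c2E [leRHS]mulrAC ler_wpM2r ?invr_ge0 //; lra.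
have SV1 : SV <= c3 * (L ^+ 2 * q ^+ 2).
  have : 6 * N * XA * q ^+ 2 <= 6 * N * XA * (L ^+ 2 * q ^+ 2).
    rewrite ler_wpM2l ?mulr_ge0 // ler_peMl  //.
  by rewrite SVE c3E; lra.
have c20 : 0 <= c2.
  by rewrite c2E divr_ge0 // addr_ge0 // !mulr_ge0 // addr_ge0 // mulr_ge0.
have c30 : 0 <= c3 by rewrite c3E addr_ge0 // !mulr_ge0.
have c40 : 0 <= c4 by rewrite c4E addr_ge0 // !mulr_ge0.
have SV0 : 0 <= SV.
  rewrite SVE addr_ge0 //; last by rewrite !mulr_ge0.
  by rewrite mulr_ge0 // SrE divr_ge0 // addr_ge0 // mulr_ge0.
have G0 : 0 <= l + l * N * C by rewrite addr_ge0 // !mulr_ge0.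
have G1 : l + l * N * C <= c4 * L.
  have := ler_wpM2l (mulr_ge0 l0 N0) CL; have := ler_wpM2l l0 L1.
  by rewrite c4E; lra.
have lN : 0 <= l * N by rewrite mulr_ge0.
have T1 : l * N * (2 + n1 * C) * (C * (K * q ^+ 2)) <=
    l * N * (2 + n1 * s) * (s * K) * (L ^+ 3 * q ^+ 3).
  have A0 : 0 <= (2 + n1 * s) * (s * K) by rewrite !mulr_ge0 // addr_ge0 // mulr_ge0.
  have := ler_wpM2l lN (le_trans db (ler_wpM2l A0 LQ)).
  by rewrite !mulrA.
have T2 : (l * N + gamma) * Sr <= (l * N + gamma) * c2 * (L ^+ 3 * q ^+ 3).
  rewrite -[leRHS]mulrA ler_wpM2l ?addr_ge0 //; apply: le_trans Sr1 _.
  by rewrite ler_wpM2l.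
have T3 : 2 * (l + l * N * C) * n1 * (SV + 1) <=
    2 * c4 * n1 * (c3 + 1) * (L ^+ 3 * q ^+ 3).
  have SV2 : SV + 1 <= (c3 + 1) * (L ^+ 2 * q ^+ 2) by lra.
  have : (l + l * N * C) * (SV + 1) <= c4 * L * ((c3 + 1) * (L ^+ 2 * q ^+ 2)).
    by rewrite ler_pM // addr_ge0.
  have : c4 * (c3 + 1) * (L ^+ 3 * q ^+ 2) <= c4 * (c3 + 1) * (L ^+ 3 * q ^+ 3).
    by rewrite ler_wpM2l ?mulr_ge0 ?addr_ge0 // ler_wpM2l // exprn_ge0.
  have -> : c4 * L * ((c3 + 1) * (L ^+ 2 * q ^+ 2)) =
    c4 * (c3 + 1) * (L ^+ 3 * q ^+ 2) by ring.
  move=> A1 A2; have := ler_wpM2l (mulr_ge0 (ler0n R 2) n10) (le_trans A2 A1).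
  lra.
(* The step size [1/q] balances this term, of order [q^4 / q], with the next one, of order
   [q^2 q]. *)
have T4 : q ^+ 4 * n1 ^+ 3 * (l + l * N * C) ^+ 2 * q^-1 <=
    n1 ^+ 3 * c4 ^+ 2 * (L ^+ 3 * q ^+ 3).
  have -> : q ^+ 4 * n1 ^+ 3 * (l + l * N * C) ^+ 2 * q^-1 =
    n1 ^+ 3 * ((l + l * N * C) ^+ 2 * q ^+ 3).
    by field; exact: lt0r_neq0.
  rewrite -[leRHS]mulrA; apply: ler_wpM2l; first exact: exprn_ge0.
  apply: (@le_trans _ _ ((c4 * L) ^+ 2 * q ^+ 3)).
    rewrite ler_wpM2r // lerXn2r // nnegrE //.
    by rewrite mulr_ge0.
  by rewrite exprMn -[leLHS]mulrA ler_wpM2l ?sqr_ge0.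
have T5 : n1 * Psi * (2 + SV) / q^-1 <= n1 * Psi * (2 + c3) * (L ^+ 3 * q ^+ 3).
  rewrite invrK -[leLHS]mulrA -[leRHS]mulrA ler_wpM2l ?mulr_ge0 //.
  apply: (@le_trans _ _ ((2 + c3) * (L ^+ 2 * q ^+ 2) * q)).
    rewrite ler_wpM2r ?(ltW q0) //; lra.
  have -> : (2 + c3) * (L ^+ 2 * q ^+ 2) * q = (2 + c3) * (L ^+ 2 * q ^+ 3) by ring.
  by rewrite ler_wpM2l // addr_ge0.
lra.
Qed.

End Growth.

(** * Estimates as functions of the past *)

Section Saturation.
Context (R : realType) (X A : finType) (N : nat).

Lemma occ_ext (p q : nat -> X * A -> X -> R) pi nu n :
  (forall k z x, (1 <= k <= n)%N -> p k z x = q k z x) ->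
  occ p pi nu n = occ q pi nu n.
Proof.
elim: n => // n IHn pq; apply/funext => z /=.
rewrite IHn => [|k z' x /andP[k1 kn]]; last by rewrite pq // k1 leqW.
by apply: eq_bigr => z' _; rewrite pq // leqnn.
Qed.

Lemma phat_past t n z x (w w' : nat -> nat -> X * A) : (1 <= n <= N)%N ->
  same_past N t w w' -> phat R w t n z x = phat R w' t n z x.
Proof.
move=> /andP[n1 nN] sp; have nN' : (n.-1 <= N)%N by rewrite (leq_trans (leq_pred _)).
rewrite /phat (visits_past z nN' sp); congr (if _ then _ else _%:R / _).
rewrite /trans_visits !big_nat; apply: eq_bigr => s st.
by rewrite !sp // prednK.
Qed.

End Saturation.

(** * The regret on a good sample path *)

Section Assembly.
Context (R : realType).

(* For large T the extra logarithmic factor of the theorem absorbs this constant. *)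
Definition kappa (X A : finType) (N : nat) (alpha l gamma Psi delta : R) : R :=
  let n1 : R := N.+1%:R in
  let s : R := Num.sqrt (2 * #|X|%:R) in
  let K : R := 3 * N%:R * #|{: X * A}|%:R / delta in
  let c2 := (2 + (2 + n1 * s) * (s * K)) / (1 - alpha) in
  let c3 := 2 * c2 + 6 * N%:R * #|{: X * A}|%:R in
  let c4 := l + l * N%:R * s in
  l * N%:R * (2 + n1 * s) * (s * K) + (l * N%:R + gamma) * c2 +
  2 * c4 * n1 * (c3 + 1) + n1 ^+ 3 * c4 ^+ 2 + n1 * (Psi + 1) * (2 + c3).

(** Its inverse is the learning rate; [maxn 1] keeps that rate positive at [T = 0]. *)
Definition quartic_root (T : nat) : R := Num.sqrt (Num.sqrt (maxn 1 T)%:R).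

Lemma quartic_root_ge1 T : 1 <= quartic_root T.
Proof.
rewrite /quartic_root -[leLHS]sqrtr1 ler_wsqrtr // -[leLHS]sqrtr1 ler_wsqrtr //.
by rewrite ler1n leq_max.
Qed.

Lemma quartic_root_sqr T : (0 < T)%N -> quartic_root T ^+ 2 = Num.sqrt T%:R.
Proof. by move=> T0; rewrite /quartic_root (maxn_idPr _) // sqr_sqrtr // sqrtr_ge0. Qed.

Lemma quartic_root_powR T : (0 < T)%N -> quartic_root T ^+ 3 = T%:R `^ (3 / 4).
Proof.
move=> T0; rewrite /quartic_root (maxn_idPr _) // -powR12_sqrt ?sqrtr_ge0 //.
rewrite -powR12_sqrt // -powRrM -powR_mulrn ?powR_ge0 // -powRrM.
by congr (_ `^ _); field.
Qed.

(** A deterministic statement: the two good events enter as hypotheses, namely accuracy of the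
    kernels and a visit sum of at most [1/delta] times the bound on its expectation. *)
Lemma path_regret (X A : finType) (N T : nat) (dv : divergence)
  (alpha l gamma delta Psi : R) (p : nat -> X * A -> X -> R) (rho : X * A -> R)
  (w : nat -> nat -> X * A) (f : nat -> nat -> (X * A -> R) -> R)
  (pi : nat -> nat -> X -> A -> R) (mu g : nat -> nat -> X * A -> R)
  (pis : nat -> X -> A -> R) :
  (0 < T)%N -> 0 <= alpha < 1 -> 0 <= l -> 0 <= gamma -> 0 < delta -> 0 <= Psi ->
  1 <= logterm X A N T delta ->
  is_kernel N p -> is_dist rho -> is_policy N pis -> push N p pis rho = rho ->
  (forall nu nu' : X * A -> R, is_dist nu -> is_dist nu' ->
     l1dist (push N p pis nu) (push N p pis nu') <= alpha * l1dist nu nu') ->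
  mdpp_k N T dv (quartic_root T)^-1 alpha l delta p rho w f pi mu g ->
  (forall t, (1 <= t <= T)%N -> objective_ok N l (f t)) ->
  (forall t n z, (1 <= t <= T)%N -> (n < N)%N ->
     l1dist (phat R w t n.+1 z) (p n.+1 z) <= bonus N T delta w t n z) ->
  (forall t, (1 <= t <= T)%N ->
     norm1oo N (grad_psi dv (mu t) (pi t)) <= Psi%:E)%E ->
  \sum_(1 <= t < T.+1) \sum_(0 <= n < N) \sum_z
    occ p (pi t) (rho_seq N p rho pi t) n z /
    Num.sqrt (maxn 1 (visits w t n z))%:R <=
  3 * N%:R * #|{: X * A}|%:R * Num.sqrt T%:R / delta ->
  regret N T gamma p rho f pi pis <=
  kappa X A N alpha l gamma Psi delta *
    (logterm X A N T delta ^+ 3 * quartic_root T ^+ 3).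
Proof.
move=> T0 al l0 g0 d0 Psi0 L1 kp drho kpis per contr run ok acc grad vis.
set q := quartic_root T; set L := logterm X A N T delta.
have q1 : 1 <= q by exact: quartic_root_ge1.
have q0 : 0 < q^-1 by rewrite invr_gt0 (lt_le_trans ltr01).
set C := Cdelta X A N T delta.
have pos t : (1 <= t <= T)%N -> positive N dv (mu t) (pi t).
  by move=> tT; exact: grad_positive (grad t tT).
have logs t n z : (1 <= t <= T)%N -> (n <= N)%N ->
    `|logref dv (mu t) (pi t) n z| <= Psi + 1.
  by move=> tT nN; exact: grad_logref (grad t tT) nN.
pose K : R := 3 * N%:R * #|{: X * A}|%:R / delta.
have HB : \sum_(1 <= t < T.+1)
    dotp N (occ p (pi t) (rho_seq N p rho pi t)) (bonus N T delta w t) <=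
    C * (K * q ^+ 2).
  have -> : \sum_(1 <= t < T.+1)
      dotp N (occ p (pi t) (rho_seq N p rho pi t)) (bonus N T delta w t) =
    C * \sum_(1 <= t < T.+1) \sum_(0 <= n < N) \sum_z
    occ p (pi t) (rho_seq N p rho pi t) n z /
    Num.sqrt (maxn 1 (visits w t n z))%:R.
    rewrite mulr_sumr; apply: eq_bigr => t _.
    rewrite /dotp big_nat_recr //= [X in _ + X]big1 ?addr0 => [|z _]; last first.
      by rewrite /bonus ltnn mulr0.
    rewrite mulr_sumr !big_nat; apply: eq_bigr => n /andP[_ nN].
    rewrite mulr_sumr; apply: eq_bigr => z _.
    by rewrite /bonus nN mulrCA.
  rewrite ler_wpM2l ?Cdelta_ge0 //; apply: le_trans vis _.
  rewrite /q quartic_root_sqr // /K le_eqVlt; apply/orP; left; apply/eqP.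
  by field; exact: lt0r_neq0.
have := regret_bound T0 al l0 q0 kp drho kpis per contr run ok acc pos logs g0 HB
  erefl erefl.
move=> /le_trans; apply; rewrite /kappa -/K.
have TE : T%:R = q ^+ 4 :> R.
  by rewrite -[4%N]/(2 * 2)%N exprM quartic_root_sqr // sqr_sqrtr.
have CL : C <= Num.sqrt (2 * #|X|%:R) * L.
  rewrite /C /Cdelta [leLHS]sqrtrM ?mulr_ge0 // ler_wpM2l ?sqrtr_ge0 //.
  rewrite -(@ler_pXn2r _ 2) ?nnegrE ?sqrtr_ge0 //; last exact: le_trans L1.
  rewrite sqr_sqrtr; last exact: le_trans L1.
  by rewrite -/L -{1}[L]expr1 ler_weXn2l.
have [a0 a1] := andP al.
have K0 : 0 <= K by rewrite divr_ge0 ?mulr_ge0 // ltW.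
have := @regret_growth R q L N.+1%:R N%:R l gamma alpha (Psi + 1) C
  (Num.sqrt (2 * #|X|%:R)) K #|{: X * A}|%:R _ _ _ _ _
  q1 L1 (ler0n _ _) (ler0n _ _) l0 g0 a1 (addr_ge0 Psi0 ler01)
  (Cdelta_ge0 _ _ _ _ _) CL K0 (ler0n _ _) erefl erefl erefl erefl erefl.
by rewrite -quartic_root_sqr // -/q TE.
Qed.

End Assembly.

(** * The event as a function of the observations *)

Section Event.
Context (R : realType) (X A : finType) (N T : nat).
Variables (p : nat -> X * A -> X -> R) (rho : X * A -> R).
Context (d : measure_display) (Omega : measurableType d) (P : probability Omega R).
Variables (W : Omega -> nat -> nat -> X * A).
Variables (f : Omega -> nat -> nat -> (X * A -> R) -> R).
Variables (pi : Omega -> nat -> nat -> X -> A -> R).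
Hypothesis inter : interaction N T p rho P W f pi.
Variables (dv : divergence) (eta alpha l gamma delta : R).
Variables (mu g : Omega -> nat -> nat -> X * A -> R) (pis : nat -> X -> A -> R).
Hypothesis kp : is_kernel N p.
Hypothesis drho : is_dist rho.
Hypothesis run : forall om,
  mdpp_k N T dv eta alpha l delta p rho (W om) (f om) (pi om) (mu om) (g om).

(** The minimiser may fail to be unique, yet it is determined by the past: it is the flow of
    [pi om t] under the estimated kernels, and that policy is a function of the past. *)
Lemma mu_past om om' t n : (1 <= t <= T)%N -> (n <= N)%N ->
  same_past N t (W om) (W om') -> mu om t n = mu om' t n.
Proof.
move=> tT nN sp; rewrite (mu_occ (run om) tT nN) (mu_occ (run om') tT nN).
rewrite (rho_seq_past inter tT sp) (policy_past inter tT sp).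
apply: occ_ext => k z x /andP[k1 kn]; apply: (@phat_past R X A N t k z x _ _ _ sp).
by rewrite k1 (leq_trans kn).
Qed.

Lemma norm_grad_past om om' t : (1 <= t <= T)%N ->
  same_past N t (W om) (W om') ->
  norm1oo N (grad_psi dv (mu om t) (pi om t)) =
  norm1oo N (grad_psi dv (mu om' t) (pi om' t)).
Proof.
move=> tT sp; rewrite /norm1oo !big_nat; apply: eq_bigr => n nN.
apply: eq_bigr => z _; rewrite /grad_psi (policy_past inter tT sp).
by rewrite (mu_past tT nN sp) (mu_past tT (leq0n N) sp).
Qed.

Lemma regret_past om om' : same_past N T.+1 (W om) (W om') ->
  regret N T gamma p rho (f om) (pi om) pis =
  regret N T gamma p rho (f om') (pi om') pis.
Proof.
move=> sp.
have E t : (1 <= t <= T)%N -> [/\ f om t = f om' t, pi om t = pi om' t &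
    rho_seq N p rho (pi om) t = rho_seq N p rho (pi om') t].
  move=> tT; have tT1 : (t.+1 <= T.+1)%N by case/andP: tT.
  have spS := same_past_le tT1 sp; have spt := same_past_le (leqnSn t) spS.
  split; first exact: (objective_past inter tT spS).
    exact: (policy_past inter tT spt).
  exact: (rho_seq_past inter tT spt).
rewrite /regret; congr (_ + _ * _); rewrite !big_nat; apply: eq_bigr => t tT.
  by have [-> -> ->] := E t tT.
by have [_ _ ->] := E t tT.
Qed.

End Event.

(* [eta T N #|X| #|A| alpha l Psi delta (psi mu_1)] is the learning rate. *)
Theorem theorem4 (R : realType) :
  exists (c C : R) (k : nat)
    (eta : nat -> nat -> nat -> nat -> R -> R -> R -> R -> R -> R),
  (forall T N nX nA alpha l Psi delta r,
     0 < eta T N nX nA alpha l Psi delta r) /\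
  forall (X A : finType) (N : nat) (alpha l gamma Psi delta : R),
  (0 < N)%N -> 0 <= alpha < 1 -> 0 < l -> 0 < gamma -> 0 < delta < 1 ->
  exists T0 : nat, forall T : nat, (T0 <= T)%N ->
  forall (dv : divergence) (p : nat -> X * A -> X -> R) (rho : X * A -> R),
  is_kernel N p -> is_dist rho ->
  (exists pi0, periodic_policy N p rho pi0) ->
  (forall pi0, periodic_policy N p rho pi0 ->
     forall nu nu' : X * A -> R, is_dist nu -> is_dist nu' ->
       norm1 (fun z => push N p pi0 nu z - push N p pi0 nu' z) <=
       alpha * norm1 (fun z => nu z - nu' z)) ->
  forall (d : measure_display) (Omega : measurableType d)
    (P : probability Omega R)
    (W : Omega -> nat -> nat -> X * A)
    (f : Omega -> nat -> nat -> (X * A -> R) -> R)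
    (pi : Omega -> nat -> nat -> X -> A -> R)
    (mu g : Omega -> nat -> nat -> X * A -> R),
  interaction N T p rho P W f pi ->
  (forall om t, (1 <= t <= T)%N -> objective_ok N l (f om t)) ->
  (forall om,
     mdpp_k N T dv
       (eta T N #|X| #|A| alpha l Psi delta (psi N dv (mu om 1%N)))
       alpha l delta p rho (W om) (f om) (pi om) (mu om) (g om)) ->
  forall pis, periodic_policy N p rho pis ->
  ((1 - c * delta)%:E <=
   P [set om |
      (forall t, (1 <= t <= T)%N ->
         norm1oo N (grad_psi dv (mu om t) (pi om t)) <= Psi%:E)%E ->
      (regret N T gamma p rho (f om) (pi om) pis <=
       C * rate X A N T alpha l Psi * logterm X A N T delta ^+ k)%R])%E.
Proof.
(* 5 is 4 for inaccurate kernels plus 1 for the visit sum; the power 4 is the [L^3] of the path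
   bound and one factor to absorb [kappa]. *)
exists 5, 1, 4%N, (fun T _ _ _ _ _ _ _ _ => (quartic_root R T)^-1); split.
  by move=> T *; rewrite invr_gt0 (lt_le_trans ltr01) ?quartic_root_ge1.
move=> X A N alpha l gamma Psi delta N0 al l0 g0 /andP[d0 d1'].
have d5 : 1 - 5 * delta <= 1 by lra.
(* No run meets the gradient bound with [Psi <= 0], so the event is then the whole space. Otherwise
   [r0] below is positive and can be divided by. *)
have [Psi0|Psi0] := leP Psi 0.
  exists 1%N => T T0 dv p rho kp drho _ _ d Omega P W f pi mu g inter ok run pis _.
  rewrite [X in P X](_ : _ = setT) ?probability_setT ?lee_fin //.
  apply/seteqP; split=> // om _ /= /(_ 1%N); rewrite T0 => /(_ isT) H.
  have dmu : is_dist (mu om 1%N 0%N) by rewrite (run_start (run om)).2.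
  by have := grad_norm_gt0 dmu H; lra.
pose r0 : R := l * N%:R ^+ 3 * #|X|%:R `^ (5 / 4) * #|A|%:R `^ (1 / 4) *
  Num.sqrt (Psi * (1 - alpha)^-1).
(* Once [M <= L], the 2 serves the union bound and the quotient gives [kappa <= r0 L]. Since
   [L >= ln T], taking [T > expR M] suffices. *)
pose M := 2 + `|kappa X A N alpha l gamma Psi delta / r0|.
exists (Num.bound (expR M)).+1.
move=> T T0 dv p rho kp drho _ contr d Omega P W f pi mu g inter ok run pis [kpis per].
have Tpos : (0 < T)%N by exact: leq_trans T0.
have /card_gt0P[[x0 a0] _] := dist_card drho.
have X0 : 1 <= #|X|%:R :> R by rewrite ler1n; apply/card_gt0P; exists x0.
have A0 : 1 <= #|A|%:R :> R by rewrite ler1n; apply/card_gt0P; exists a0.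
have N1 : 1 <= N%:R :> R by rewrite ler1n.
have [al0 al1] := andP al.
have r0_gt0 : 0 < r0.
  rewrite /r0 !mulr_gt0 ?exprn_gt0 ?powR_gt0 ?sqrtr_gt0 ?ltr0n //.
  - by rewrite -(ltr0n R); lra.
  - by rewrite -(ltr0n R); lra.
  by rewrite mulr_gt0 // invr_gt0 subr_gt0.
set L := logterm X A N T delta.
have LM : M <= L.
  rewrite -(expRK M) /L /logterm ler_ln ?posrE ?expR_gt0 //; last first.
    by rewrite divr_gt0 // !mulr_gt0 ?ltr0n // -(ltr0n R); lra.
  apply: (@le_trans _ _ T%:R).
    apply: ltW; apply: lt_le_trans (archi_boundP (expR_ge0 M)) _.
    by rewrite ler_nat ltnW.
  rewrite ler_pdivlMr //.
  have T0' : 0 <= T%:R :> R by [].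
  apply: (@le_trans _ _ (T%:R * 1)); first by rewrite ler_wpM2l // ltW.
  rewrite mulr1 -[leLHS]mul1r ler_wpM2r //.
  by rewrite -[leLHS]mul1r ler_pM // -[leLHS]mul1r ler_pM.
have L2 : 2 <= L by apply: le_trans LM; rewrite /M lerDl.
have kL : kappa X A N alpha l gamma Psi delta <= r0 * L.
  rewrite mulrC -ler_pdivrMr //; apply: le_trans (ler_norm _) _.
  by apply: le_trans LM; rewrite /M lerDr.
have kpi om t : (1 <= t <= T)%N -> is_policy N (pi om t).
  by move=> tT n x; exact: (run_policy (run om) tT).
have [rep [repK1 repK]] := ex_rep N T P W.
set Ev := (X in P X).
(* [Ev] is unchanged when the sample point varies with the same observations, so it is a union of
   sets on which [code] is constant. *)
have -> : P Ev = (\sum_(h | `[< Ev (rep h) >]) weight P W h)%:E.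
  rewrite -(P_code inter); congr (P _); apply/seteqP; split=> om /=; set om' := rep _.
    move=> Eom; apply/asboolP; have sp : same_past N T.+1 (W om) (W om').
      by apply: code_same; rewrite repK1.
    move=> H /=; rewrite -(regret_past inter gamma pis sp); apply: Eom => t tT.
    rewrite (norm_grad_past inter run tT (om' := om')) ?H //.
    by apply: same_past_le sp; case/andP: tT => _ /leqW.
  move=> /asboolP Eom'; have sp : same_past N T.+1 (W om) (W om').
    by apply: code_same; rewrite repK1.
  move=> H /=; rewrite (regret_past inter gamma pis sp); apply: Eom' => t tT.
  rewrite -(norm_grad_past inter run tT (om := om)) ?H //.
  by apply: same_past_le sp; case/andP: tT => _ /leqW.
rewrite lee_fin.
(* The bound on the expected visit sum divided by [delta], so that Markov's inequality leaves
   probability at most [delta]. *)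
pose K := 3 * N%:R * #|{: X * A}|%:R * Num.sqrt T%:R / delta.
pose phi h : R := \sum_(1 <= t < T.+1) \sum_(0 <= n < N) \sum_z
    occ p (pi (rep h) t) (rho_seq N p rho (pi (rep h)) t) n z /
    Num.sqrt (maxn 1 (visits (W (rep h)) t n z))%:R.
have K0 : 0 < K.
  rewrite /K !mulr_gt0 ?invr_gt0 ?sqrtr_gt0 ?ltr0n //.
  exact: dist_card drho.
have phi0 h : 0 <= phi h.
  rewrite /phi big_nat; apply: sumr_ge0 => t tT; rewrite big_nat.
  apply: sumr_ge0 => n /andP[_ nN]; apply: sumr_ge0 => z _.
  by rewrite divr_ge0 ?sqrtr_ge0 // (tr_dist kp drho (run _) tT (ltnW nN)).1.
have bad2 : \sum_(h | K <= phi h) weight P W h <= delta.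
  apply: le_trans (weight_markov P W K0 phi0) _; rewrite ler_pdivrMr //.
  apply: le_trans (expected_visit_weight inter kp kpi repK) _.
  by rewrite /K [leRHS]mulrC divfK // lt0r_neq0.
have bad1 := inaccurate_whp inter kp kpi drho repK N0 Tpos d0 L2.
have := @sum_weight_union R X A N T d Omega P W bool
  (fun h => ~~ `[< Ev (rep h) >])
  (fun b h => if b then `[< inaccurate N T p W delta (rep h) >] else K <= phi h).
rewrite big_bool /= => bad.
have := sum_weight inter; rewrite (bigID (fun h => `[< Ev (rep h) >])) /= => total.
suff H : forall h, ~~ `[< Ev (rep h) >] -> exists b : bool,
    if b then `[< inaccurate N T p W delta (rep h) >] else K <= phi h.
  by have := bad H; lra.
move=> h /asboolPn nEv.
have [acc|acc] := asboolP (inaccurate N T p W delta (rep h)); first by exists true.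
exists false; rewrite leNgt; apply/negP => vis; apply: nEv => grad /=.
apply: le_trans (path_regret Tpos al (ltW l0) (ltW g0) d0 (ltW Psi0) _ kp drho kpis per
  (contr _ (conj kpis per)) (run _) (ok _) _ grad (ltW vis)) _.
- by apply: le_trans L2; rewrite ler1n.
- by move=> t n z tT nN; rewrite leNgt; apply/negP => lt; apply: acc; exists t, n, z.
rewrite mul1r -/L.
have L0 : 0 <= L by lra.
have Q0 : 0 <= quartic_root R T ^+ 3.
  by rewrite exprn_ge0 // (le_trans ler01) ?quartic_root_ge1.
apply: (@le_trans _ _ (r0 * L * (L ^+ 3 * quartic_root R T ^+ 3))).
  by rewrite ler_wpM2r // mulr_ge0 // exprn_ge0.
have -> : r0 * L * (L ^+ 3 * quartic_root R T ^+ 3) =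
  r0 * quartic_root R T ^+ 3 * L ^+ 4 by ring.
rewrite ler_wpM2r ?exprn_ge0 // quartic_root_powR // /rate -/r0 lerDl.
by rewrite !mulr_ge0 ?exprn_ge0 ?sqrtr_ge0 ?invr_ge0 ?subr_ge0 // ltW.
Qed.
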